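(* There is an algorithm which, given an $n$-vertex graph $G$ by means of an RDV representation (a rooted tree $T$ together with, for each vertex $v$ of $G$, references to the two nodes $t(v)$ and $b(v)$ of $T$ that delimit its downward path), computes a maximum matching of $G$ in $O(|T|+n\log n)$ time.
   Context: An RDV representation of a graph $G$ consists of a rooted tree $T$ (nodes are its vertices; $|T|$ is its number of nodes) and, for every vertex $v$ of $G$, a downward path $P(v)$ in $T$ (a path that starts at some node and then always proceeds from a node to one of its children), such that for distinct vertices $v,w$, $vw$ is an edge of $G$ iff $P(v)$ and $P(w)$ share at least one node. $t(v)$ is the node of $P(v)$ closest to the root and $b(v)$ the node farthest from the root. A maximum matching is a set of pairwise vertex-disjoint edges of maximum cardinality. Run time is measured in the standard word-RAM model. *)

(* Defs.v *)
From Stdlib Require Import Arith List Lia.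
Import ListNotations.

(* Word-RAM model with word size w: memory is an array of words       *)
(* (nat -> nat, all cells initially holding values < 2^w), every      *)
(* instruction costs one unit of time.                                *)

Inductive binop : Type :=
| OAdd | OSub | OMul | ODiv | OMod | OLt | OEq | OAnd | OOr | OXor | OShl | OShr.

Inductive instr : Type :=
| IConst (d k : nat)
| IBin (op : binop) (d a b : nat)
| ILoad (d a : nat)
| IStore (a s : nat)
| IJz (a target : nat)
| IJmp (target : nat)
| IHalt.

Definition program := list instr.

Definition eval_binop (w : nat) (op : binop) (x y : nat) : nat :=
  let W := 2 ^ w in
  match op with
  | OAdd => (x + y) mod W
  | OSub => (W + x - y) mod W
  | OMul => (x * y) mod W
  | ODiv => x / y
  | OMod => x mod y
  | OLt => if x <? y then 1 else 0
  | OEq => if x =? y then 1 else 0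
  | OAnd => Nat.land x y
  | OOr => Nat.lor x y
  | OXor => Nat.lxor x y
  | OShl => (Nat.shiftl x y) mod W
  | OShr => Nat.shiftr x y
  end.

Definition upd (m : nat -> nat) (a v : nat) : nat -> nat :=
  fun x => if x =? a then v else m x.

Definition step (w : nat) (i : instr) (pc : nat) (m : nat -> nat)
  : nat * (nat -> nat) :=
  match i with
  | IConst d k => (S pc, upd m d (k mod 2 ^ w))
  | IBin op d a b => (S pc, upd m d (eval_binop w op (m a) (m b)))
  | ILoad d a => (S pc, upd m d (m (m a)))
  | IStore a s => (S pc, upd m (m a) (m s))
  | IJz a t => (if m a =? 0 then t else S pc, m)
  | IJmp t => (t, m)
  | IHalt => (pc, m)
  end.

Fixpoint run (p : program) (w fuel pc : nat) (m : nat -> nat)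
  : option (nat -> nat) :=
  match nth_error p pc with
  | None => Some m
  | Some IHalt => Some m
  | Some i =>
      match fuel with
      | O => None
      | S f => let '(pc', m') := step w i pc m in run p w f pc' m'
      end
  end.

(* The rooted tree T has nodes 0..N-1, root r, and parent function par *)
(* (par r = r).  Graph G has vertices 0..n-1; vertex v has the        *)
(* downward path P(v) from t v (top) to b v (bottom).                 *)

Definition anc (par : nat -> nat) (x y : nat) : Prop :=
  exists k, Nat.iter k par y = x.

Definition rooted_tree (N r : nat) (par : nat -> nat) : Prop :=
  r < N /\ par r = r /\
  (forall x, x < N -> par x < N) /\
  (forall x, x < N -> anc par r x).

Definition valid_rdv (N n r : nat) (par tv bv : nat -> nat) : Prop :=
  rooted_tree N r par /\
  (forall v, v < n -> tv v < N /\ bv v < N /\ anc par (tv v) (bv v)).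

Definition on_path (par tv bv : nat -> nat) (v x : nat) : Prop :=
  anc par (tv v) x /\ anc par x (bv v).

Definition rdv_edge (N n : nat) (par tv bv : nat -> nat) (v u : nat) : Prop :=
  v < n /\ u < n /\ v <> u /\
  exists x, x < N /\ on_path par tv bv v x /\ on_path par tv bv u x.

Fixpoint endpoints (M : list (nat * nat)) : list nat :=
  match M with
  | [] => []
  | (a, b) :: M' => a :: b :: endpoints M'
  end.

Definition is_matching (E : nat -> nat -> Prop) (M : list (nat * nat)) : Prop :=
  (forall a b, In (a, b) M -> E a b) /\ NoDup (endpoints M).

Definition is_maximum_matching (E : nat -> nat -> Prop) (M : list (nat * nat))
  : Prop :=
  is_matching E M /\ forall M', is_matching E M' -> length M' <= length M.

Definition input_mem (N n r : nat) (par tv bv : nat -> nat) : nat -> nat :=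
  fun a =>
    if a =? 0 then N
    else if a =? 1 then n
    else if a =? 2 then r
    else if a <? 3 + N then par (a - 3)
    else if a <? 3 + N + 2 * n then
      (if Nat.even (a - (3 + N)) then tv ((a - (3 + N)) / 2)
       else bv ((a - (3 + N)) / 2))
    else 0.

Definition output_is (m : nat -> nat) (M : list (nat * nat)) : Prop :=
  m 0 = length M /\
  forall i, i < length M -> nth_error M i = Some (m (1 + 2 * i), m (2 + 2 * i)).

(* Main.v *)
Require Import Defs.
From Stdlib Require Import Arith List Lia Permutation.
Import ListNotations.

(* Treat the nodes of the tree children first and, at node [x], the vertices
   [w] with [t w = x] one by one.  Match [w] with the waiting vertex [v] whose
   node [t v] is met first on the way up from [b w]; if there is none, [w]
   starts waiting at [x].  Waiting vertices are pairwise non-adjacent, so at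
   most one waits at each node.  If an optimal completion of the current
   matching uses [v a] and [w c] instead of [v w], then the path of [a] contains
   all nodes from [t v] up to [x], and the path of [c] meets that segment, so
   [v w] and [a c] do as well.

   A treated node where nobody waits will never be used again and is merged into
   its parent with union-find, union being by size.  Merging a node at the end
   of its treatment takes constant time since both classes are known; only the
   O(n) searches and later merges cost O(log |T|), and
   n log |T| = O(|T| + n log n). *)

(** * Structured programs and their compilation *)

(** A node can acquire a waiting vertex only while it is being treated, so a treated node without
    one is useless for good. The node [x] under treatment and its ancestors are still undeleted;
    hence the nearest undeleted ancestor of [b w] lies at or below [x], and it either hosts the
    deepest waiting vertex on the way up or is [x] itself. One search thus settles the whole choice
    for [w]. A node whose waiting vertex is matched after its own treatment also has to be deleted;
    that merge is charged to the vertex just treated. The claim concerns a concrete list of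
    instructions, so the program is written in a structured language whose compilation keeps exact
    step counts, and every specification carries a budget of steps. The input format is a further
    obstacle: the input fills the low cells, while arithmetic instructions only work on fixed cells.
    The data are therefore moved into interleaved arrays before the computation, and the result is
    moved back afterwards. *)

Inductive cmd : Type :=
| CI (i : instr)
| CSeq (c1 c2 : cmd)
| CIf (a : nat) (c1 c2 : cmd)
| CWhile (c : cmd) (a : nat) (b : cmd).

Fixpoint size (c : cmd) : nat :=
  match c with
  | CI _ => 1
  | CSeq c1 c2 => size c1 + size c2
  | CIf _ c1 c2 => size c1 + size c2 + 2
  | CWhile c _ b => size c + size b + 2
  end.

(** Jump targets are absolute, hence the start address [o]. A loop test may need several
    instructions: [CWhile c a b] runs [c] before every test of cell [a]. *)
Fixpoint compile (o : nat) (c : cmd) : program :=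
  match c with
  | CI i => [i]
  | CSeq c1 c2 => compile o c1 ++ compile (o + size c1) c2
  | CIf a c1 c2 =>
      IJz a (o + 1 + size c1 + 1) :: compile (o + 1) c1 ++
      IJmp (o + size c1 + size c2 + 2) :: compile (o + 1 + size c1 + 1) c2
  | CWhile c a b =>
      compile o c ++ IJz a (o + size c + size b + 2) ::
      compile (o + size c + 1) b ++ [IJmp o]
  end.

Definition simple (i : instr) : bool :=
  match i with IJz _ _ | IJmp _ | IHalt => false | _ => true end.

Definition effect (w : nat) (i : instr) (m : nat -> nat) : nat -> nat :=
  snd (step w i 0 m).

(** The number counts machine instructions exactly: a first branch pays for the test and for the
    jump over the second branch, a turn of a loop for the test and the jump back. *)
Inductive exec (w : nat) : cmd -> (nat -> nat) -> nat -> (nat -> nat) -> Prop :=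
| E_I i m : simple i = true -> exec w (CI i) m 1 (effect w i m)
| E_seq c1 c2 m k1 m1 k2 m2 :
    exec w c1 m k1 m1 -> exec w c2 m1 k2 m2 ->
    exec w (CSeq c1 c2) m (k1 + k2) m2
| E_if_true a c1 c2 m k m' :
    m a <> 0 -> exec w c1 m k m' -> exec w (CIf a c1 c2) m (k + 2) m'
| E_if_false a c1 c2 m k m' :
    m a = 0 -> exec w c2 m k m' -> exec w (CIf a c1 c2) m (k + 1) m'
| E_while_false c a b m k m1 :
    exec w c m k m1 -> m1 a = 0 -> exec w (CWhile c a b) m (k + 1) m1
| E_while_true c a b m k1 m1 k2 m2 k3 m3 :
    exec w c m k1 m1 -> m1 a <> 0 -> exec w b m1 k2 m2 ->
    exec w (CWhile c a b) m2 k3 m3 ->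
    exec w (CWhile c a b) m (k1 + k2 + 2 + k3) m3.

Lemma length_compile c : forall o, length (compile o c) = size c.
Proof.
  induction c; intros; simpl; rewrite ?length_app; simpl; rewrite ?length_app; simpl;
    rewrite ?IHc1, ?IHc2; lia.
Qed.

Definition code_at (p : program) (o : nat) (l : program) : Prop :=
  exists pre post, p = pre ++ l ++ post /\ length pre = o.

Lemma code_at_app_l p o l1 l2 : code_at p o (l1 ++ l2) -> code_at p o l1.
Proof.
  intros (pre & post & -> & <-). exists pre, (l2 ++ post).
  now rewrite <- app_assoc.
Qed.

Lemma code_at_app_r p o l1 l2 :
  code_at p o (l1 ++ l2) -> code_at p (o + length l1) l2.
Proof.
  intros (pre & post & -> & <-). exists (pre ++ l1), post.
  rewrite length_app, <- !app_assoc. auto.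
Qed.

Lemma code_at_cons p o i l :
  code_at p o (i :: l) -> nth_error p o = Some i /\ code_at p (o + 1) l.
Proof.
  intros H. split.
  - destruct H as (pre & post & -> & <-).
    rewrite nth_error_app2, Nat.sub_diag; auto.
  - apply (code_at_app_r p o [i] l H).
Qed.

Lemma run_instr p w o i f m :
  nth_error p o = Some i -> i <> IHalt ->
  run p w (S f) o m = run p w f (fst (step w i o m)) (snd (step w i o m)).
Proof.
  intros H Hi. cbn [run]. rewrite H.
  destruct i; try reflexivity. congruence.
Qed.

(** Since [k] is the exact number of executed instructions, the fuel [f] left over is arbitrary,
    which makes the statement compose along the induction. *)
Lemma exec_run w c m k m' :
  exec w c m k m' -> forall p o f, code_at p o (compile o c) ->
  run p w (k + f) o m = run p w f (o + size c) m'.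
Proof.
  induction 1; intros p o f Hc; simpl in Hc.
  - apply code_at_cons in Hc as [Hi _].
    change (1 + f) with (S f). rewrite (run_instr _ _ _ _ _ _ Hi).
    + simpl size. rewrite Nat.add_1_r. destruct i; simpl in *; try discriminate; reflexivity.
    + destruct i; discriminate.
  - pose proof (code_at_app_l _ _ _ _ Hc) as H1.
    pose proof (code_at_app_r _ _ _ _ Hc) as H2.
    rewrite length_compile in H2.
    rewrite <- Nat.add_assoc, IHexec1, IHexec2 by assumption.
    simpl. f_equal; lia.
  - apply code_at_cons in Hc as [Hi Hc].
    pose proof (code_at_app_l _ _ _ _ Hc) as H1.
    pose proof (code_at_app_r _ _ _ _ Hc) as H2.
    rewrite length_compile in H2. apply code_at_cons in H2 as [Hj H2].
    replace (k + 2 + f) with (S (k + S f)) by lia.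
    rewrite (run_instr _ _ _ _ _ _ Hi) by discriminate.
    cbn [step fst snd]. apply Nat.eqb_neq in H. rewrite H.
    replace (S o) with (o + 1) by lia. rewrite IHexec by assumption.
    rewrite (run_instr _ _ _ _ _ _ Hj) by discriminate.
    cbn. f_equal; lia.
  - apply code_at_cons in Hc as [Hi Hc].
    pose proof (code_at_app_r _ _ _ _ Hc) as H2.
    rewrite length_compile in H2. apply code_at_cons in H2 as [_ H2].
    replace (k + 1 + f) with (S (k + f)) by lia.
    rewrite (run_instr _ _ _ _ _ _ Hi) by discriminate.
    cbn [step fst snd]. rewrite H. cbn [Nat.eqb].
    rewrite IHexec by assumption. cbn. f_equal; lia.
  - pose proof (code_at_app_l _ _ _ _ Hc) as H1.
    pose proof (code_at_app_r _ _ _ _ Hc) as H2.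
    rewrite length_compile in H2. apply code_at_cons in H2 as [Hi _].
    replace (k + 1 + f) with (k + S f) by lia.
    rewrite IHexec by assumption.
    rewrite (run_instr _ _ _ _ _ _ Hi) by discriminate.
    cbn [step fst snd]. rewrite H0. cbn. f_equal; lia.
  - pose proof (code_at_app_l _ _ _ _ Hc) as H4.
    pose proof (code_at_app_r _ _ _ _ Hc) as H5.
    rewrite length_compile in H5. apply code_at_cons in H5 as [Hi H5].
    pose proof (code_at_app_l _ _ _ _ H5) as H6.
    pose proof (code_at_app_r _ _ _ _ H5) as H7.
    rewrite length_compile in H7. apply code_at_cons in H7 as [Hj _].
    replace (k1 + k2 + 2 + k3 + f) with (k1 + S (k2 + S (k3 + f))) by lia.
    rewrite IHexec1 by assumption.
    rewrite (run_instr _ _ _ _ _ _ Hi) by discriminate.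
    cbn [step fst snd]. apply Nat.eqb_neq in H0. rewrite H0.
    replace (S (o + size c)) with (o + size c + 1) by lia.
    rewrite IHexec2 by assumption.
    rewrite (run_instr _ _ _ _ _ _ Hj) by discriminate.
    cbn [step fst snd]. rewrite IHexec3 by exact Hc. reflexivity.
Qed.

(* Credit logic: [t] is a budget of machine steps and [Q] receives what is
   left of it. *)
Definition tr (w : nat) (c : cmd) (m : nat -> nat) (t : nat)
  (Q : (nat -> nat) -> nat -> Prop) : Prop :=
  exists m' k, exec w c m k m' /\ k <= t /\ Q m' (t - k).

Lemma tr_instr w i m t (Q : _ -> _ -> Prop) :
  simple i = true -> 1 <= t -> Q (effect w i m) (t - 1) -> tr w (CI i) m t Q.
Proof. intros. exists (effect w i m), 1. repeat split; auto. now constructor. Qed.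

Lemma tr_conseq w c m t (Q Q' : _ -> _ -> Prop) :
  tr w c m t Q -> (forall m' t', Q m' t' -> Q' m' t') -> tr w c m t Q'.
Proof. intros (m' & k & X & L & HQ) H. exists m', k. auto. Qed.

Lemma tr_seq w c1 c2 m t (Q : _ -> _ -> Prop) :
  tr w c1 m t (fun m' t' => tr w c2 m' t' Q) -> tr w (CSeq c1 c2) m t Q.
Proof.
  intros (m1 & k1 & H1 & L1 & m2 & k2 & H2 & L2 & HQ).
  exists m2, (k1 + k2). split; [|split]; [econstructor; eauto | lia |].
  now replace (t - (k1 + k2)) with (t - k1 - k2) by lia.
Qed.

Lemma tr_if w a c1 c2 m t (Q : _ -> _ -> Prop) :
  2 <= t ->
  (m a <> 0 -> tr w c1 m (t - 2) Q) -> (m a = 0 -> tr w c2 m (t - 1) Q) ->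
  tr w (CIf a c1 c2) m t Q.
Proof.
  intros Ht H1 H2. destruct (Nat.eq_dec (m a) 0) as [E|E].
  - destruct (H2 E) as (m' & k & He & L & HQ). exists m', (k + 1).
    split; [|split]; [now constructor | lia |].
    now replace (t - (k + 1)) with (t - 1 - k) by lia.
  - destruct (H1 E) as (m' & k & He & L & HQ). exists m', (k + 2).
    split; [|split]; [now constructor | lia |].
    now replace (t - (k + 2)) with (t - 2 - k) by lia.
Qed.

(* Each turn of the loop costs credits, so no separate variant is needed. *)
Lemma tr_while w c a b (I Q : (nat -> nat) -> nat -> Prop) :
  (forall m t, I m t ->
    tr w c m t (fun m1 t1 => 2 <= t1 /\
      (m1 a = 0 -> Q m1 (t1 - 1)) /\
      (m1 a <> 0 -> tr w b m1 (t1 - 2) I))) ->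
  forall m t, I m t -> tr w (CWhile c a b) m t Q.
Proof.
  intros H m t. revert m. induction t as [t IH] using lt_wf_ind.
  intros m Hi. destruct (H m t Hi) as (m1 & k & He & L & L2 & Hf & Ht).
  destruct (Nat.eq_dec (m1 a) 0) as [E|E].
  - exists m1, (k + 1). split; [|split]; [now constructor | lia |].
    replace (t - (k + 1)) with (t - k - 1) by lia. auto.
  - destruct (Ht E) as (m2 & k2 & He2 & L3 & Hi2).
    destruct (IH (t - k - 2 - k2)) with (m := m2) as (m3 & k3 & He3 & L4 & HQ);
      [lia | exact Hi2 |].
    exists m3, (k + k2 + 2 + k3). split; [|split]; [econstructor; eauto | lia |].
    now replace (t - (k + k2 + 2 + k3)) with (t - k - 2 - k2 - k3) by lia.
Qed.

(* Memory layout: cells below [K] are registers (variables, then the cell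
   [CR] holding the base address [C], then temporaries); entry [i] of array
   [j] lives in cell [C + J * i + j]. *)
Definition K := 32.
Definition CR := 20.
Definition T0 := 21.
Definition J := 16.

(** Cells strictly between [CR] and [K] stay unconstrained, so evaluating an expression may
    overwrite them; so do those from [K] up to [C]. *)
Definition rep (C : nat) (R : nat -> nat) (A : nat -> nat -> nat) (m : nat -> nat) : Prop :=
  (forall i, i < CR -> m i = R i) /\ m CR = C /\
  (forall j i, j < J -> m (C + J * i + j) = A j i).

Definition set {X : Type} (f : nat -> X) (a : nat) (v : X) : nat -> X :=
  fun x => if x =? a then v else f x.

Lemma set_neq {X : Type} (f : nat -> X) a v x : x <> a -> set f a v x = f x.
Proof. intros H. unfold set. apply Nat.eqb_neq in H. now rewrite H. Qed.

(** * Expressions over variables and arrays *)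

Inductive expr : Type :=
| Cst (k : nat)
| Var (x : nat)
| Add (e1 e2 : expr)
| Sub (e1 e2 : expr)
| Lt (e1 e2 : expr)
| Eq (e1 e2 : expr)
| Get (j : nat) (e : expr).

Fixpoint ev (R : nat -> nat) (A : nat -> nat -> nat) (e : expr) : nat :=
  match e with
  | Cst k => k
  | Var x => R x
  | Add e1 e2 => ev R A e1 + ev R A e2
  | Sub e1 e2 => ev R A e1 - ev R A e2
  | Lt e1 e2 => if ev R A e1 <? ev R A e2 then 1 else 0
  | Eq e1 e2 => if ev R A e1 =? ev R A e2 then 1 else 0
  | Get j e => A j (ev R A e)
  end.

(** Excludes wrap-around, so that machine values agree with values in [nat]. The contents of
    variables and arrays need no bound of their own: only constants, sums, differences and indices
    must be small. *)
Fixpoint ok (Bd : nat) (R : nat -> nat) (A : nat -> nat -> nat) (e : expr) : Prop :=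
  match e with
  | Cst k => k < Bd
  | Var x => x < CR
  | Add e1 e2 => ok Bd R A e1 /\ ok Bd R A e2 /\ ev R A e1 + ev R A e2 < Bd
  | Sub e1 e2 => ok Bd R A e1 /\ ok Bd R A e2 /\ ev R A e2 <= ev R A e1 < Bd
  | Lt e1 e2 | Eq e1 e2 => ok Bd R A e1 /\ ok Bd R A e2
  | Get j e => j < J /\ ok Bd R A e /\ ev R A e < Bd
  end.

(** A supply of consecutive temporaries sufficient for [comp], including the scratch cell of an
    array access. *)
Fixpoint depth (e : expr) : nat :=
  match e with
  | Cst _ | Var _ => 1
  | Add e1 e2 | Sub e1 e2 | Lt e1 e2 | Eq e1 e2 => Nat.max (depth e1) (S (depth e2))
  | Get _ e => S (depth e)
  end.

Fixpoint cost (e : expr) : nat :=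
  match e with
  | Cst _ | Var _ => 1
  | Add e1 e2 | Sub e1 e2 | Lt e1 e2 | Eq e1 e2 => cost e1 + cost e2 + 1
  | Get _ e => cost e + 6
  end.

Fixpoint instrs (i : instr) (l : list instr) : cmd :=
  match l with [] => CI i | i' :: l => CSeq (CI i) (instrs i' l) end.

(* Turns the index in cell [d] into an address of array [j], with [f] as scratch. *)
Definition address (d f j : nat) (l : list instr) : cmd :=
  instrs (IConst f J)
    (IBin OMul d d f :: IConst f j :: IBin OAdd d d f :: IBin OAdd d d CR :: l).

(** A cell is copied by a bitwise or with itself: the instruction set has no move, and unlike an
    addition this requires no bound on the content. *)
Fixpoint comp (d : nat) (e : expr) : cmd :=
  let bin op e1 e2 :=
    CSeq (comp d e1) (CSeq (comp (S d) e2) (CI (IBin op d d (S d)))) in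
  match e with
  | Cst k => CI (IConst d k)
  | Var x => CI (IBin OOr d x x)
  | Add e1 e2 => bin OAdd e1 e2
  | Sub e1 e2 => bin OSub e1 e2
  | Lt e1 e2 => bin OLt e1 e2
  | Eq e1 e2 => bin OEq e1 e2
  | Get j e => CSeq (comp d e) (address d (S d) j [ILoad d d])
  end.

Lemma upd_eq m a v : upd m a v a = v.
Proof. unfold upd. now rewrite Nat.eqb_refl. Qed.

Lemma upd_neq m a v x : x <> a -> upd m a v x = m x.
Proof. intros H. unfold upd. apply Nat.eqb_neq in H. now rewrite H. Qed.

Lemma rep_frame C R A m m' :
  rep C R A m -> K <= C -> (forall i, i <= CR \/ K <= i -> m' i = m i) -> rep C R A m'.
Proof.
  intros (H1 & H2 & H3) HC H. repeat split; intros.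
  - rewrite H by lia. auto.
  - rewrite H by (unfold CR; lia). auto.
  - rewrite H by lia. auto.
Qed.

Ltac upds :=
  repeat first [rewrite upd_eq | rewrite upd_neq by (unfold CR, K, T0 in *; lia)].

(** The access itself is a load in [comp] and a store in [store]; the continuation [i0 :: l] covers
    both. *)
Lemma address_exec w C Bd m d f j i :
  K <= C -> C + J * Bd <= 2 ^ w -> J <= Bd -> CR < d -> CR < f -> d <> f ->
  m CR = C -> m d = i -> i < Bd -> j < J ->
  forall l, exists m' ,
    m' d = C + J * i + j /\ (forall x, x <> d -> x <> f -> m' x = m x) /\
    forall i0 k m2, exec w (instrs i0 l) m' k m2 ->
    exec w (address d f j (i0 :: l)) m (5 + k) m2.
Proof.
  intros HC HW HJ Hd Hf Hdf HCR Hm Hi Hj l.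
  set (m1 := effect w (IConst f J) m).
  set (m2 := effect w (IBin OMul d d f) m1).
  set (m3 := effect w (IConst f j) m2).
  set (m4 := effect w (IBin OAdd d d f) m3).
  set (m5 := effect w (IBin OAdd d d CR) m4).
  assert (J = 16) as HJ16 by reflexivity.
  assert (E2 : m2 d = i * J).
  { unfold m2, m1, effect; cbn [step snd eval_binop]; upds.
    rewrite Hm, !Nat.mod_small; try nia. rewrite Nat.mod_small; nia. }
  assert (E4 : m4 d = i * J + j).
  { unfold m4, m3, effect; cbn [step snd eval_binop]; upds.
    rewrite E2. rewrite (Nat.mod_small j) by nia. rewrite Nat.mod_small; nia. }
  assert (E5 : m5 d = C + J * i + j).
  { unfold m5, effect; cbn [step snd eval_binop]; upds.
    replace (m4 CR) with C.
    - rewrite E4. rewrite Nat.mod_small; nia.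
    - unfold m4, m3, m2, m1, effect; cbn [step snd]; upds. auto. }
  exists m5. split; [exact E5|]. split.
  - intros. unfold m5, m4, m3, m2, m1, effect; cbn [step snd]; upds. auto.
  - intros i0 k m6 H. unfold address. cbn [instrs].
    change (5 + k) with (1 + (1 + (1 + (1 + (1 + k))))).
    econstructor; [now constructor|]. econstructor; [now constructor|].
    econstructor; [now constructor|]. econstructor; [now constructor|].
    econstructor; [now constructor|]. exact H.
Qed.

Lemma comp_exec w C Bd R A (HC : K <= C) (HW : C + J * Bd <= 2 ^ w) (HJ : J <= Bd) e :
  forall m d, rep C R A m -> ok Bd R A e -> CR < d -> d + depth e <= K ->
  exists m', exec w (comp d e) m (cost e) m' /\ m' d = ev R A e /\
    (forall i, i < d \/ K <= i -> m' i = m i).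
Proof.
  assert (J = 16) as HJ16 by reflexivity.
  (* Shared by the four binary operators: the second operand is evaluated from cell [S d] on, which
     leaves the first one in [d] intact. *)
  assert (BIN : forall op e1 e2 m d v,
    (forall m d, rep C R A m -> ok Bd R A e1 -> CR < d -> d + depth e1 <= K ->
      exists m', exec w (comp d e1) m (cost e1) m' /\ m' d = ev R A e1 /\
      (forall i, i < d \/ K <= i -> m' i = m i)) ->
    (forall m d, rep C R A m -> ok Bd R A e2 -> CR < d -> d + depth e2 <= K ->
      exists m', exec w (comp d e2) m (cost e2) m' /\ m' d = ev R A e2 /\
      (forall i, i < d \/ K <= i -> m' i = m i)) ->
    rep C R A m -> ok Bd R A e1 -> ok Bd R A e2 -> CR < d ->
    d + Nat.max (depth e1) (S (depth e2)) <= K ->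
    eval_binop w op (ev R A e1) (ev R A e2) = v ->
    exists m', exec w (CSeq (comp d e1) (CSeq (comp (S d) e2) (CI (IBin op d d (S d)))))
      m (cost e1 + cost e2 + 1) m' /\ m' d = v /\
      (forall i, i < d \/ K <= i -> m' i = m i)).
  { intros op e1 e2 m d v H1 H2 Hr O1 O2 Hd HK Hv.
    destruct (H1 m d) as (m1 & X1 & V1 & F1); auto; [lia|].
    assert (rep C R A m1) by (apply (rep_frame C R A m); auto; intros; apply F1; lia).
    destruct (H2 m1 (S d)) as (m2 & X2 & V2 & F2); auto; [lia|].
    exists (effect w (IBin op d d (S d)) m2). split; [|split].
    - rewrite <- Nat.add_assoc. econstructor; [exact X1|].
      econstructor; [exact X2|]. now constructor.
    - unfold effect; cbn [step snd]. rewrite upd_eq, V2, F2, V1 by lia. auto.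
    - intros i Hi. unfold effect; cbn [step snd].
      assert (i <> d) by (unfold K in *; lia).
      rewrite upd_neq, F2, F1 by lia. auto. }
  induction e; intros m d Hr Ho Hd HK; cbn [ok] in Ho; cbn [depth] in HK;
    cbn [comp cost ev]; try (eapply BIN; eauto; try tauto).
  - exists (effect w (IConst d k) m). split; [now constructor|].
    unfold effect; cbn [step snd]. rewrite upd_eq, Nat.mod_small by nia.
    split; auto. intros i Hi. apply upd_neq. unfold K in *; lia.
  - exists (effect w (IBin OOr d x x) m). split; [now constructor|].
    unfold effect; cbn [step snd eval_binop]. rewrite upd_eq, Nat.lor_diag.
    split; [now apply Hr|]. intros i Hi. apply upd_neq. unfold K in *; lia.
  - cbn. apply Nat.mod_small; nia.
  - cbn. replace (2 ^ w + ev R A e1 - ev R A e2)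
      with (ev R A e1 - ev R A e2 + 1 * 2 ^ w) by nia.
    rewrite Nat.Div0.mod_add. apply Nat.mod_small; nia.
  - destruct Ho as (Hj & Ho & Hi).
    destruct (IHe m d) as (m1 & X1 & V1 & F1); auto; [lia|].
    assert (Hr1 : rep C R A m1)
      by (apply (rep_frame C R A m); auto; intros; apply F1; lia).
    assert (1 <= depth e) by (destruct e; cbn; lia).
    destruct (address_exec w C Bd m1 d (S d) j (ev R A e)) with (l := @nil instr)
      as (m2 & V2 & F2 & X2); auto; try lia.
    { apply Hr1. }
    exists (effect w (ILoad d d) m2). split; [|split].
    + econstructor; [exact X1|]. apply X2. now constructor.
    + unfold effect; cbn [step snd]. rewrite upd_eq, V2.
      rewrite F2 by (unfold K in *; lia). now apply Hr1.
    + intros i Hi'. unfold effect; cbn [step snd].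
      rewrite upd_neq, F2, F1 by (unfold K in *; lia). auto.
Qed.

(** * Program logic for variables and arrays *)

Definition assign (x : nat) (e : expr) : cmd :=
  CSeq (comp T0 e) (CI (IBin OOr x T0 T0)).
Definition store (j : nat) (e1 e2 : expr) : cmd :=
  CSeq (comp T0 e1) (CSeq (comp (S T0) e2)
    (address T0 (S (S T0)) j [IStore T0 (S T0)])).
Definition ifE (e : expr) (c1 c2 : cmd) : cmd := CSeq (comp T0 e) (CIf T0 c1 c2).
Definition whileE (e : expr) (c : cmd) : cmd := CWhile (comp T0 e) T0 c.

(** Quantifying over all memories with the same [R] and [A] hides the temporaries and the gaps of
    the memory layout from specifications. *)
Definition TR (w C : nat) (c : cmd) (R : nat -> nat) (A : nat -> nat -> nat) (t : nat)
  (Q : (nat -> nat) -> (nat -> nat -> nat) -> nat -> Prop) : Prop :=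
  forall m, rep C R A m ->
  tr w c m t (fun m' t' => exists R' A', rep C R' A' m' /\ Q R' A' t').

Lemma TR_seq w C c1 c2 R A t Q :
  TR w C c1 R A t (fun R' A' t' => TR w C c2 R' A' t' Q) ->
  TR w C (CSeq c1 c2) R A t Q.
Proof.
  intros H m Hm. apply tr_seq. eapply tr_conseq; [apply H, Hm|].
  intros m' t' (R' & A' & Hr & H'). now apply H'.
Qed.

Section Rules.
Context (w C Bd : nat).
Context (HC : K <= C) (HW : C + J * Bd <= 2 ^ w) (HJ : J <= Bd).

Lemma TR_assign x e v R A t (Q : _ -> _ -> _ -> Prop) :
  x < CR -> T0 + depth e <= K -> ok Bd R A e -> ev R A e = v -> cost e + 1 <= t ->
  Q (set R x v) A (t - (cost e + 1)) -> TR w C (assign x e) R A t Q.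
Proof.
  intros Hx Hd Ho <- Ht HQ m Hm.
  destruct (comp_exec w C Bd R A HC HW HJ e m T0) as (m1 & X & V & F); auto;
    try (unfold CR, T0 in *; lia).
  exists (effect w (IBin OOr x T0 T0) m1), (cost e + 1).
  split; [econstructor; [exact X | now constructor]|]. split; [auto|].
  eexists _, _. split; [|exact HQ].
  unfold effect; cbn [step snd eval_binop]. rewrite V, Nat.lor_diag.
  destruct Hm as (H1 & H2 & H3).
  repeat split; intros; unfold upd, set.
  - destruct (i =? x); auto. rewrite F; [auto | unfold T0, CR in *; lia].
  - assert (CR <> x) as N by lia. apply Nat.eqb_neq in N. rewrite N.
    rewrite F; [auto | unfold T0, CR in *; lia].
  - assert (C + J * i + j <> x) as N by (unfold CR, K in *; lia).
    apply Nat.eqb_neq in N. rewrite N. rewrite F; [auto|lia].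
Qed.

Lemma TR_store j e1 e2 i v R A t (Q : _ -> _ -> _ -> Prop) :
  j < J -> T0 + S (depth e1) <= K -> T0 + S (S (depth e2)) <= K ->
  ok Bd R A e1 -> ok Bd R A e2 -> ev R A e1 = i -> ev R A e2 = v -> i < Bd ->
  cost e1 + cost e2 + 6 <= t ->
  Q R (set A j (upd (A j) i v)) (t - (cost e1 + cost e2 + 6)) ->
  TR w C (store j e1 e2) R A t Q.
Proof.
  intros Hj D1 D2 O1 O2 <- <- Hi Ht HQ m Hm.
  destruct (comp_exec w C Bd R A HC HW HJ e1 m T0) as (m1 & X1 & V1 & F1); auto;
    try (unfold CR, T0 in *; lia).
  assert (Hr1 : rep C R A m1)
    by (apply (rep_frame C R A m); auto; intros; apply F1; unfold T0, CR in *; lia).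
  destruct (comp_exec w C Bd R A HC HW HJ e2 m1 (S T0)) as (m2 & X2 & V2 & F2); auto;
    try (unfold CR, T0 in *; lia).
  assert (Hr2 : rep C R A m2)
    by (apply (rep_frame C R A m1); auto; intros; apply F2; unfold T0, CR in *; lia).
  destruct (address_exec w C Bd m2 T0 (S (S T0)) j (ev R A e1)) with (l := @nil instr)
    as (m3 & V3 & F3 & X3); auto; try (unfold CR, T0 in *; lia).
  { apply Hr2. }
  { rewrite F2; auto. }
  assert (Hr3 : rep C R A m3).
  { apply (rep_frame C R A m2); auto. intros. apply F3; unfold T0, CR, K in *; lia. }
  exists (effect w (IStore T0 (S T0)) m3), (cost e1 + cost e2 + 6).
  split; [|split; [auto|]].
  { rewrite <- Nat.add_assoc. econstructor; [exact X1|].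
    econstructor; [exact X2|]. apply X3. now constructor. }
  eexists _, _. split; [|exact HQ].
  unfold effect; cbn [step snd]. rewrite V3, F3, V2 by lia.
  destruct Hr3 as (H1 & H2 & H3). assert (J = 16) by reflexivity.
  repeat split; intros; unfold upd, set.
  - assert (i <> C + J * ev R A e1 + j) as N by (unfold K, CR in *; lia).
    apply Nat.eqb_neq in N. rewrite N. auto.
  - assert (CR <> C + J * ev R A e1 + j) as N by (unfold K, CR in *; lia).
    apply Nat.eqb_neq in N. rewrite N. auto.
  - destruct (Nat.eqb_spec j0 j) as [->|Nj].
    + unfold upd. destruct (Nat.eqb_spec i (ev R A e1)) as [->|Ni].
      * now rewrite Nat.eqb_refl.
      * replace (_ =? _) with false by (symmetry; apply Nat.eqb_neq; nia). auto.
    + replace (_ =? _) with false by (symmetry; apply Nat.eqb_neq; nia). auto.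
Qed.

Lemma TR_if e c1 c2 R A t Q :
  T0 + depth e <= K -> ok Bd R A e -> cost e + 2 <= t ->
  (ev R A e <> 0 -> TR w C c1 R A (t - (cost e + 2)) Q) ->
  (ev R A e = 0 -> TR w C c2 R A (t - (cost e + 1)) Q) ->
  TR w C (ifE e c1 c2) R A t Q.
Proof.
  intros Hd Ho Ht H1 H2 m Hm.
  destruct (comp_exec w C Bd R A HC HW HJ e m T0) as (m1 & X & V & F); auto;
    try (unfold CR, T0 in *; lia).
  assert (Hr : rep C R A m1)
    by (apply (rep_frame C R A m); auto; intros; apply F; unfold T0, CR in *; lia).
  apply tr_seq. exists m1, (cost e). split; [auto|split; [lia|]].
  apply tr_if; [lia| |]; rewrite V; intros E.
  - replace (t - cost e - 2) with (t - (cost e + 2)) by lia. now apply H1.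
  - replace (t - cost e - 1) with (t - (cost e + 1)) by lia. now apply H2.
Qed.

Lemma TR_while (I : (nat -> nat) -> (nat -> nat -> nat) -> nat -> Prop) e c R A t Q :
  I R A t -> T0 + depth e <= K ->
  (forall R A t, I R A t -> ok Bd R A e /\ cost e + 2 <= t /\
    (ev R A e = 0 -> Q R A (t - (cost e + 1))) /\
    (ev R A e <> 0 -> TR w C c R A (t - (cost e + 2)) I)) ->
  TR w C (whileE e c) R A t Q.
Proof.
  intros Hi Hd H m Hm. unfold whileE.
  apply tr_while with (I := fun m t => exists R A, rep C R A m /\ I R A t);
    [|now exists R, A].
  clear R A t Hi m Hm. intros m t (R & A & Hm & Hi).
  destruct (H R A t Hi) as (Ho & Ht & Hf & Hb).
  destruct (comp_exec w C Bd R A HC HW HJ e m T0) as (m1 & X & V & F); auto;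
    try (unfold CR, T0 in *; lia).
  assert (Hr : rep C R A m1)
    by (apply (rep_frame C R A m); auto; intros; apply F; unfold T0, CR in *; lia).
  exists m1, (cost e). split; [auto|split; [lia|]]. rewrite V. split; [lia|].
  split; intros E.
  - exists R, A. split; auto.
    replace (t - cost e - 1) with (t - (cost e + 1)) by lia. auto.
  - replace (t - cost e - 2) with (t - (cost e + 2)) by lia.
    now apply Hb.
Qed.

End Rules.

(** * Union-find on deleted tree nodes *)

Section Tree.
Context (N r : nat) (par : nat -> nat).
Context (HT : rooted_tree N r par).

Lemma iter_add (f : nat -> nat) a b x :
  Nat.iter (a + b) f x = Nat.iter a f (Nat.iter b f x).
Proof. induction a; simpl; congruence. Qed.

Lemma par_lt x : x < N -> par x < N.
Proof. apply HT. Qed.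

Lemma iter_lt k x : x < N -> Nat.iter k par x < N.
Proof. intros Hx. induction k; simpl; auto using par_lt. Qed.

Lemma anc_refl x : anc par x x.
Proof. now exists 0. Qed.

Lemma anc_par x y : anc par x (par y) -> anc par x y.
Proof. intros [k <-]. exists (S k). apply Nat.iter_succ_r. Qed.

Lemma anc_trans x y z : anc par x y -> anc par y z -> anc par x z.
Proof. intros [a <-] [b <-]. exists (a + b). apply iter_add. Qed.

Lemma anc_lt x y : y < N -> anc par x y -> x < N.
Proof. intros H [k <-]. now apply iter_lt. Qed.

Lemma anc_comparable a b z : anc par a z -> anc par b z -> anc par a b \/ anc par b a.
Proof.
  intros [i <-] [j <-]. destruct (le_ge_dec i j).
  - right. exists (j - i). rewrite <- iter_add. f_equal; lia.
  - left. exists (i - j). rewrite <- iter_add. f_equal; lia.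
Qed.

Lemma iter_root k : Nat.iter k par r = r.
Proof. induction k; simpl; auto. rewrite IHk. apply HT. Qed.

(** If [x] reaches the root in [j] steps, then [j] rounds of the cycle, at least [j] steps, end at
    the root and also at [x]. *)
Lemma cycle_root k x : x < N -> 0 < k -> Nat.iter k par x = x -> x = r.
Proof.
  intros Hx Hk E. destruct HT as (_ & _ & _ & Hr). destruct (Hr x Hx) as [j Hj].
  assert (E' : forall i, Nat.iter (i * k) par x = x).
  { induction i; simpl; auto. rewrite iter_add, IHi. auto. }
  rewrite <- (E' j). replace (j * k) with ((j * k - j) + j) by nia.
  rewrite iter_add, Hj. apply iter_root.
Qed.

Lemma par_fix x : x < N -> par x = x -> x = r.
Proof. intros Hx E. apply (cycle_root 1); auto. Qed.

Lemma anc_antisym a b : a < N -> anc par a b -> anc par b a -> a = b.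
Proof.
  intros Ha [i Hi] [j Hj].
  destruct i as [|i]; [symmetry; exact Hi|].
  assert (a = r).
  { apply (cycle_root (S i + j)); auto; [lia|]. rewrite iter_add, Hj. auto. }
  rewrite H, iter_root in Hj. congruence.
Qed.

Lemma down_closed (P : nat -> Prop) a b :
  (forall c, c < N -> P (par c) -> P c) -> b < N -> anc par a b -> P a -> P b.
Proof.
  intros HP Hb [k E]. revert b Hb E. induction k; intros b Hb E Ha; simpl in E.
  - now subst.
  - apply HP; auto. apply (IHk (par b)); auto using par_lt.
    rewrite <- E. change (par (Nat.iter k par b)) with (Nat.iter (S k) par b).
    now rewrite Nat.iter_succ_r.
Qed.

(** An inductive definition: a derivation also certifies that an undeleted ancestor exists, and it
    provides the induction along the way up. *)
Inductive nearest (Del : nat -> Prop) : nat -> nat -> Prop :=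
| near_here z : ~ Del z -> nearest Del z z
| near_up z y : Del z -> nearest Del (par z) y -> nearest Del z y.

Lemma nearest_anc Del z y :
  nearest Del z y ->
  anc par y z /\ ~ Del y /\ forall y2, anc par y2 z -> anc par y2 y \/ Del y2.
Proof.
  induction 1 as [z H | z y H H' (IH1 & IH2 & IH3)].
  - repeat split; auto using anc_refl.
  - split; [now apply anc_par | split; auto].
    intros y2 [[|k] E]; simpl in E; [right; congruence|].
    apply IH3. exists k. rewrite <- Nat.iter_succ_r. auto.
Qed.

Lemma nearest_ext (Del Del' : nat -> Prop) z y :
  (forall x, Del x <-> Del' x) -> nearest Del z y -> nearest Del' z y.
Proof.
  intros H. induction 1; [apply near_here | apply near_up]; auto; rewrite <- H; auto.
Qed.

(** Only searches that used to end at [y] change, and they continue from [par y]. The condition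
    [y' <> y] makes [y'] survive the deletion; it fails only at the root. *)
Lemma nearest_delete (Del Del' : nat -> Prop) z y y' :
  (forall x, Del' x <-> Del x \/ x = y) ->
  nearest Del (par y) y' -> y' <> y -> forall q, nearest Del z q ->
  nearest Del' z (if q =? y then y' else q).
Proof.
  intros H Hp Hy.
  assert (Hp' : nearest Del' (par y) y').
  { clear - H Hp Hy. induction Hp as [z Hz | z q Hz _ IH].
    - apply near_here. rewrite H. tauto.
    - apply near_up; auto. rewrite H. auto. }
  induction 1 as [z Hz | z q Hz _ IH].
  - destruct (Nat.eqb_spec z y) as [->|Hn].
    + apply near_up; auto. rewrite H. auto.
    + apply near_here. rewrite H. tauto.
  - apply near_up; auto. rewrite H. auto.
Qed.

Lemma nearest_par_neq Del y y' :
  y < N -> y <> r -> nearest Del (par y) y' -> y' <> y.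
Proof.
  intros Hy Hr Hn E. subst y'. apply nearest_anc in Hn as ([k Hk] & _).
  apply Hr, (cycle_root (S k)); auto; [lia|]. now rewrite Nat.iter_succ_r.
Qed.

Fixpoint sumf (f : nat -> nat) (k : nat) : nat :=
  match k with 0 => 0 | S k => sumf f k + f k end.

Lemma sumf_ext f g k : (forall i, i < k -> f i = g i) -> sumf f k = sumf g k.
Proof. induction k; intros H; simpl; auto. rewrite IHk, H; auto. Qed.

Lemma sumf_set f i v k : i < k -> sumf (upd f i v) k + f i = sumf f k + v.
Proof.
  induction k; intros H; simpl; [lia|]. unfold upd at 2.
  destruct (Nat.eqb_spec k i) as [->|Hn].
  - rewrite (sumf_ext (upd f i v) f); [lia|].
    intros j Hj. unfold upd. replace (j =? i) with false; auto.
    symmetry. apply Nat.eqb_neq. lia.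
  - assert (i < k) by lia. specialize (IHk H0). lia.
Qed.

Lemma sumf_ge f i k : i < k -> f i <= sumf f k.
Proof.
  induction k; intros H; simpl; [lia|].
  destruct (Nat.eq_dec i k) as [->|]; [lia|]. specialize (IHk ltac:(lia)). lia.
Qed.

(** The invariant that these values add up to [N] bounds the size of every class without counting
    its members. *)
Definition root_sizes (u sz : nat -> nat) (z : nat) : nat :=
  if u z =? 0 then sz z else 0.

(* Union-find forest of the deleted nodes: [u z] is 0 at a root and one plus
   the parent elsewhere; [top] maps the root of a class to its only undeleted
   node, [rp] is the inverse of that map.  The ghost data are [rt], sending a
   node to the root of its class, and the union-by-size ranks [rk]. *)
Record dsu_ghost (Del : nat -> Prop) (u sz top rp rt rk : nat -> nat) : Prop := {
  d_root : forall z, z < N -> rt z < N /\ u (rt z) = 0;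
  d_top : forall z, z < N -> top (rt z) < N /\ nearest Del z (top (rt z));
  d_mem : forall z, z < N -> rt (top (rt z)) = rt z;
  d_self : forall z, z < N -> u z = 0 -> rt z = z;
  d_step : forall z q, z < N -> u z = S q -> q < N /\ rt q = rt z /\ rk z < rk q;
  d_rp : forall y, y < N -> ~ Del y -> rp y = rt y;
  d_pow : forall z, z < N -> u z = 0 -> 2 ^ rk z <= sz z;
  d_sum : sumf (root_sizes u sz) N = N;
  d_rk : forall z, z < N -> rk z <= rk (rt z)
}.

Definition dsu (Del : nat -> Prop) (u sz top rp : nat -> nat) : Prop :=
  exists rt rk, dsu_ghost Del u sz top rp rt rk.

Lemma dsu_ext (Del Del' : nat -> Prop) u sz top rp :
  (forall x, Del x <-> Del' x) -> dsu Del u sz top rp -> dsu Del' u sz top rp.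
Proof.
  intros H (rt & rk & []). exists rt, rk. constructor; auto.
  - intros z Hz. destruct (d_top0 z Hz). split; auto. eapply nearest_ext; eauto.
  - intros y Hy Hd. apply d_rp0; auto. now rewrite H.
Qed.

Lemma dsu_size Del u sz top rp rt rk z :
  dsu_ghost Del u sz top rp rt rk -> z < N -> u z = 0 -> sz z <= N.
Proof.
  intros [] Hz Hu. rewrite <- d_sum0.
  pose proof (sumf_ge (root_sizes u sz) z N Hz) as H.
  unfold root_sizes at 1 in H. now rewrite Hu in H.
Qed.

(** Ranks do not decrease towards the class root, where [2 ^ rk <= sz <= N]; this is the logarithmic
    bound given by union by size. *)
Lemma dsu_rank Del u sz top rp rt rk z :
  dsu_ghost Del u sz top rp rt rk -> z < N -> rk z <= Nat.log2 N.
Proof.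
  intros G Hz. destruct (d_root _ _ _ _ _ _ _ G z Hz) as [H1 H2].
  transitivity (rk (rt z)); [apply G; auto|].
  apply Nat.log2_le_pow2; [lia|].
  transitivity (sz (rt z)); [apply G; auto | eapply dsu_size; eauto].
Qed.

Lemma dsu_init u sz top rp :
  (forall z, z < N -> u z = 0 /\ sz z = 1 /\ top z = z /\ rp z = z) ->
  dsu (fun _ => False) u sz top rp.
Proof.
  intros H. exists (fun z => z), (fun _ => 0).
  constructor; intros; try (destruct (H _ H0) as (? & ? & ? & ?)); auto; try lia.
  - rewrite H3. split; auto. now apply near_here.
  - simpl. lia.
  - assert (E : forall k, k <= N -> sumf (root_sizes u sz) k = k).
    { induction k; simpl; auto. intros. rewrite IHk by lia.
      destruct (H k) as (E1 & E2 & _); [lia|]. unfold root_sizes. rewrite E1, E2. simpl. lia. }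
    auto.
Qed.

(** Sizes decide which root [o] is hung below the other root [c], but the top of the merged class is
    [top b] in either case, because searches that ended at [y] now continue at its parent. *)
Lemma dsu_link Del Del' u sz top rp rt rk y a b o c :
  dsu_ghost Del u sz top rp rt rk ->
  y < N -> ~ Del y -> y <> r -> (forall x, Del' x <-> Del x \/ x = y) ->
  a = rt y -> b = rt (par y) ->
  o = a /\ c = b \/ o = b /\ c = a -> sz o <= sz c ->
  dsu Del' (upd u o (S c)) (upd sz c (sz c + sz o)) (upd top c (top b))
    (upd rp (top b) c).
Proof.
  intros G Hy Hd Hr HD Ea Eb Hoc Hsz.
  assert (Hp : par y < N) by now apply par_lt.
  destruct (d_root _ _ _ _ _ _ _ G y Hy) as [La Ua].
  destruct (d_root _ _ _ _ _ _ _ G _ Hp) as [Lb Ub].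
  destruct (d_top _ _ _ _ _ _ _ G _ Hy) as [_ Ta].
  destruct (d_top _ _ _ _ _ _ _ G _ Hp) as [Ltb Tb].
  rewrite <- Ea in *. rewrite <- Eb in *.
  assert (Tay : top a = y).
  { inversion Ta; subst; auto. contradiction. }
  assert (Hby : top b <> y) by (eapply nearest_par_neq; eauto).
  assert (Hab : a <> b) by (intros ->; auto).
  assert (Hne : o <> c) by lia.
  assert (Lo : o < N) by (destruct Hoc as [[-> ->]|[-> ->]]; auto).
  assert (Lc : c < N) by (destruct Hoc as [[-> ->]|[-> ->]]; auto).
  assert (Uo : u o = 0) by (destruct Hoc as [[-> ->]|[-> ->]]; auto).
  assert (Uc : u c = 0) by (destruct Hoc as [[-> ->]|[-> ->]]; auto).
  assert (Ro : rt o = o) by (apply G; auto).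
  assert (Rc : rt c = c) by (apply G; auto).
  set (rt' := fun z => if rt z =? o then c else rt z).
  (* The least new rank of [c] that exceeds the rank of its new child. It keeps [d_pow] because
     [2 ^ S (rk o) <= 2 * sz o <= sz c + sz o], [o] being the smaller class. *)
  set (rk' := upd rk c (Nat.max (rk c) (S (rk o)))).
  assert (Hrk : forall z, rk z <= rk' z).
  { intros z. unfold rk', upd. destruct (Nat.eqb_spec z c); subst; lia. }
  assert (Hrt' : forall z, rt' z <> o).
  { intros z. unfold rt'. destruct (Nat.eqb_spec (rt z) o); auto. }
  assert (Rin : forall z, rt z = a \/ rt z = b -> rt' z = c).
  { intros z Hz. unfold rt'. destruct (Nat.eqb_spec (rt z) o); lia. }
  assert (Rout : forall z, rt z <> a -> rt z <> b -> rt' z = rt z).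
  { intros z H1 H2. unfold rt'. destruct (Nat.eqb_spec (rt z) o); lia. }
  (* By [d_mem], the class of [a] consists of all nodes whose top is [y], so the array update has
     precisely the effect described by [nearest_delete]. *)
  assert (Htop : forall z, z < N -> upd top c (top b) (rt' z) =
     if top (rt z) =? y then top b else top (rt z)).
  { intros z Hz.
    destruct (Nat.eq_dec (rt z) a) as [E1|E1]; [|destruct (Nat.eq_dec (rt z) b) as [E2|E2]].
    - rewrite Rin by auto. unfold upd. now rewrite E1, Tay, !Nat.eqb_refl.
    - rewrite Rin by auto. unfold upd. rewrite E2, Nat.eqb_refl.
      apply Nat.eqb_neq in Hby. now rewrite Hby.
    - rewrite Rout by auto. unfold upd.
      replace (rt z =? c) with false by (symmetry; apply Nat.eqb_neq; lia).
      replace (top (rt z) =? y) with false; auto. symmetry. apply Nat.eqb_neq.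
      intros E. apply E1. rewrite <- (d_mem _ _ _ _ _ _ _ G z Hz), E. auto. }
  assert (Rtb : rt (top b) = b) by (rewrite Eb; apply G; auto).
  exists rt', rk'. constructor.
  - intros z Hz. destruct (d_root _ _ _ _ _ _ _ G z Hz) as [L U]. split.
    + unfold rt'. destruct (rt z =? o); auto.
    + unfold upd. specialize (Hrt' z). apply Nat.eqb_neq in Hrt'. rewrite Hrt'.
      unfold rt'. destruct (rt z =? o); auto.
  - intros z Hz. rewrite Htop by auto. destruct (d_top _ _ _ _ _ _ _ G z Hz) as [L T].
    split; [destruct (_ =? _); auto|]. eapply nearest_delete; eauto.
  - intros z Hz. rewrite Htop by auto.
    destruct (d_top _ _ _ _ _ _ _ G z Hz) as [L T].
    pose proof (d_mem _ _ _ _ _ _ _ G z Hz) as Hm.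
    destruct (Nat.eqb_spec (top (rt z)) y) as [E|E].
    + assert (rt z = a) by (rewrite <- Hm, E; auto). rewrite !Rin; auto.
    + unfold rt' at 1. rewrite Hm. reflexivity.
  - intros z Hz. unfold upd. destruct (Nat.eqb_spec z o) as [->|Hzo]; [discriminate|].
    intros U. rewrite <- (d_self _ _ _ _ _ _ _ G z Hz U) in Hzo.
    unfold rt'. apply Nat.eqb_neq in Hzo. rewrite Hzo. now apply G.
  - intros z q Hz. unfold upd. destruct (Nat.eqb_spec z o) as [->|Hzo]; intros E.
    + injection E as <-. split; auto. split.
      * unfold rt'. rewrite Ro, Rc, Nat.eqb_refl. destruct (_ =? _); auto.
      * unfold rk', upd. rewrite Nat.eqb_refl. apply Nat.eqb_neq in Hne. rewrite Hne. lia.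
    + destruct (d_step _ _ _ _ _ _ _ G z q Hz E) as (L & R & X).
      split; auto. split; [unfold rt'; now rewrite R|].
      specialize (Hrk q). unfold rk' at 1, upd.
      destruct (Nat.eqb_spec z c) as [->|]; [congruence | lia].
  - intros y2 Hy2 Hd2. rewrite HD in Hd2. unfold upd.
    assert (T : top (rt y2) = y2).
    { destruct (d_top _ _ _ _ _ _ _ G y2 Hy2) as [_ T]. inversion T; [congruence | tauto]. }
    destruct (Nat.eqb_spec y2 (top b)) as [->|E]; [rewrite Rin; auto|].
    rewrite Rout; [apply G; tauto | |]; intros E'; rewrite E' in T; [|auto].
    apply Hd2. right. congruence.
  - intros z Hz. unfold rk', upd at 1 2 3. destruct (Nat.eqb_spec z o); [discriminate|].
    intros U. destruct (Nat.eqb_spec z c) as [->|Hc]; [|apply G; auto].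
    pose proof (d_pow _ _ _ _ _ _ _ G c Lc Uc). pose proof (d_pow _ _ _ _ _ _ _ G o Lo Uo).
    destruct (Nat.max_spec (rk c) (S (rk o))) as [[_ ->]|[_ ->]]; simpl; lia.
  (* The size of [o] disappears from the sum, as [o] is no longer a root, and is added at [c]. *)
  - set (f := root_sizes u sz).
    assert (Fo : f o = sz o) by (unfold f, root_sizes; now rewrite Uo).
    assert (Fc : f c = sz c) by (unfold f, root_sizes; now rewrite Uc).
    rewrite (sumf_ext _ (upd (upd f o 0) c (f c + f o))).
    + pose proof (sumf_set (upd f o 0) c (f c + f o) N Lc) as H1.
      pose proof (sumf_set f o 0 N Lo) as H2.
      pose proof (d_sum _ _ _ _ _ _ _ G) as H3. fold f in H3.
      assert (upd f o 0 c = f c); [|lia]. unfold upd.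
      replace (c =? o) with false; auto. symmetry. apply Nat.eqb_neq; auto.
    + intros i Hi. unfold root_sizes at 1. unfold upd. rewrite Fc, Fo.
      destruct (Nat.eqb_spec i o) as [->|Hio].
      * apply Nat.eqb_neq in Hne. now rewrite Hne.
      * destruct (Nat.eqb_spec i c) as [->|]; auto. now rewrite Uc.
  - intros z Hz. pose proof (d_rk _ _ _ _ _ _ _ G z Hz).
    destruct (Nat.eq_dec z c) as [->|Hzc].
    + unfold rt'. rewrite Rc. destruct (_ =? _); lia.
    + assert (E : rk' z = rk z).
      { unfold rk', upd. apply Nat.eqb_neq in Hzc. now rewrite Hzc. }
      rewrite E. unfold rt'. destruct (Nat.eqb_spec (rt z) o) as [E'|_].
      * rewrite E' in H. unfold rk', upd. rewrite Nat.eqb_refl. lia.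
      * specialize (Hrk (rt z)). lia.
Qed.

End Tree.

(** * The greedy exchange argument *)

Lemma endpoints_app M1 M2 : endpoints (M1 ++ M2) = endpoints M1 ++ endpoints M2.
Proof. induction M1 as [|[a b] M1 IH]; simpl; congruence. Qed.

(** Edges are stored as ordered pairs, in either orientation and in any position; passing to
    endpoints up to permutation removes these case distinctions from the exchange argument. *)
Lemma extract_edge (E : nat -> nat -> Prop) R v :
  (forall a b, E a b -> E b a) -> (forall a b, In (a, b) R -> E a b) ->
  In v (endpoints R) ->
  exists a R', Permutation (endpoints R) (v :: a :: endpoints R') /\ E v a /\
    length R = S (length R') /\ (forall a b, In (a, b) R' -> E a b).
Proof.
  intros Hs. induction R as [|[p q] R IH]; simpl; intros HE Hv; [contradiction|].
  destruct Hv as [->|[->|Hv]].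
  - exists q, R. split; [reflexivity|auto].
  - exists p, R. split; [apply perm_swap|auto 6].
  - destruct IH as (a & R' & HP & Ha & HL & HR); auto.
    exists a, ((p, q) :: R'). simpl. split; [|split; [auto|split; [auto|]]].
    + rewrite HP. rewrite (perm_swap v q). rewrite (perm_swap a q).
      rewrite (perm_swap v p). rewrite (perm_swap a p). reflexivity.
    + intros ? ? [[= <- <-]|H]; auto.
Qed.

Section Greedy.
Context (N n r : nat) (par tv bv : nat -> nat).
Context (HV : valid_rdv N n r par tv bv).

Let HT : rooted_tree N r par := proj1 HV.
Let E := rdv_edge N n par tv bv.

Lemma edge_intro v u x :
  v < n -> u < n -> v <> u ->
  anc par (tv v) x -> anc par x (bv v) -> anc par (tv u) x -> anc par x (bv u) -> E v u.
Proof.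
  intros Hv Hu Hn ? ? ? ?. do 3 (split; auto). exists x. repeat split; auto.
  eapply anc_lt; eauto. now apply HV.
Qed.

Lemma edge_sym v u : E v u -> E u v.
Proof. intros (? & ? & ? & x & ? & ? & ?). repeat split; auto. exists x; auto. Qed.

(** [D] lists the treated vertices. The field [g_opt] expresses that [M] extends to an optimal
    matching, stated against every [M'] so that no optimum has to be chosen; taking [M'] empty, it
    also shows that [M] is a matching. *)
Record greedy (Seen : nat -> Prop) (D : list nat) (M : list (nat * nat))
  (wt : nat -> nat) : Prop := {
  g_nodup : NoDup D;
  g_lt : forall v, In v D -> v < n /\ Seen (tv v);
  g_cov : forall v, In v D -> In v (endpoints M) \/ wt (tv v) = S v;
  g_wt : forall y v, y < N -> wt y = S v ->
    In v D /\ tv v = y /\ ~ In v (endpoints M);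
  g_inc : incl (endpoints M) D;
  g_ind : forall v u, In v D -> In u D ->
    ~ In v (endpoints M) -> ~ In u (endpoints M) -> ~ E v u;
  g_opt : forall M', is_matching E M' ->
    exists R, is_matching E (M ++ R) /\ length M' <= length M + length R
}.

Lemma greedy_init Seen wt : (forall y, y < N -> wt y = 0) -> greedy Seen [] [] wt.
Proof.
  intros H. constructor; simpl; try easy.
  - constructor.
  - intros y v Hy Hw. rewrite H in Hw by auto. discriminate.
  - intros M' HM. exists M'. simpl. auto.
Qed.

Lemma greedy_weaken (S S' : nat -> Prop) D M wt :
  (forall z, S z -> S' z) -> greedy S D M wt -> greedy S' D M wt.
Proof.
  intros H []. constructor; auto. intros v Hv. destruct (g_lt0 v Hv). auto.
Qed.

(** An edge in the completion [R] would join two treated vertices unmatched by [M], which are never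
    adjacent; hence [R] is empty. *)
Lemma greedy_final Seen D M wt :
  greedy Seen D M wt -> (forall v, v < n -> In v D) -> is_maximum_matching E M.
Proof.
  intros G HD.
  assert (O : forall M', is_matching E M' -> is_matching E M /\ length M' <= length M).
  { intros M' HM'. destruct (g_opt _ _ _ _ G M' HM') as (R & [HE HN] & HL).
    destruct R as [|[a b] R].
    - rewrite app_nil_r in *. split; [split; auto | simpl in HL; lia].
    - exfalso. assert (Eab : E a b) by (apply HE, in_app_iff; simpl; auto).
      rewrite endpoints_app in HN. simpl in HN.
      refine (g_ind _ _ _ _ G a b _ _ _ _ Eab); try (apply HD, Eab).
      + apply NoDup_remove_2 in HN. rewrite in_app_iff in HN. tauto.
      + change (a :: b :: endpoints R) with ([a] ++ b :: endpoints R) in HN.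
        rewrite app_assoc in HN. apply NoDup_remove_2 in HN.
        rewrite !in_app_iff in HN. tauto. }
  split; [|apply O].
  apply (O []). split; [easy | constructor].
Qed.

(** Endpoints are distinct and smaller than [n]. The bound keeps the output within the addressable
    part of its array. *)
Lemma greedy_size Seen D M wt : greedy Seen D M wt -> 2 * length M <= n.
Proof.
  intros G. destruct (g_opt _ _ _ _ G []) as (R & [_ HN] & _).
  { split; [easy | constructor]. }
  rewrite endpoints_app in HN. apply NoDup_app_remove_r in HN.
  rewrite <- (length_seq n 0). transitivity (length (endpoints M)).
  - clear. induction M as [|[a b] M IH]; simpl in *; lia.
  - apply NoDup_incl_length; auto. intros v Hv. apply in_seq.
    apply (g_inc _ _ _ _ G) in Hv. apply (g_lt _ _ _ _ G) in Hv. lia.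
Qed.

(* The state while the vertices with top node [x] are treated: [Fin] holds the
   nodes treated before [x]. *)
Section Step.
Context (Fin : nat -> Prop) (x : nat).
Let Seen z := Fin z \/ z = x.
Context (Hx : x < N) (HFx : ~ Fin x).
Context (HF : forall c, c < N -> Fin (par c) -> Fin c).
Context (HS : forall c, c < N -> Seen (par c) -> Seen c).

(** The ancestors of [z] form a chain, and children are treated before parents; so a node [q] not
    yet finished cannot lie strictly below a node [s] already reached. This places the top nodes
    relative to each other throughout the exchange. *)
Lemma late_above q s z :
  z < N -> ~ Fin q -> Seen s -> anc par q z -> anc par s z -> anc par q s.
Proof.
  intros Hz Hq Hs H1 H2. destruct (anc_comparable _ _ _ _ H1 H2) as [H|H]; auto.
  assert (Lq : q < N) by (eapply anc_lt; eauto).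
  pose proof (down_closed _ _ _ HT Seen s q HS Lq H Hs) as [Q|Q]; [contradiction|].
  subst q. destruct Hs as [Hs | ->]; [|apply anc_refl].
  exfalso. apply HFx. exact (down_closed _ _ _ HT Fin s x HF Lq H Hs).
Qed.

Context (D : list nat) (M : list (nat * nat)) (wt : nat -> nat) (w : nat).
Context (G : greedy Seen D M wt).
Context (Hrem : forall v, v < n -> Fin (tv v) -> In v D).
Context (Hw : w < n) (HwD : ~ In w D) (Hwx : tv w = x).

Lemma waiting_seen y v : y < N -> wt y = S v -> Seen y.
Proof.
  intros Hy Hv. destruct (g_wt _ _ _ _ G y v Hy Hv) as (I & <- & _).
  now apply (g_lt _ _ _ _ G).
Qed.

Lemma bv_lt v : v < n -> bv v < N.
Proof. apply HV. Qed.

Lemma tv_bv v : v < n -> anc par (tv v) (bv v).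
Proof. apply HV. Qed.

(* The exchange step: if an optimal completion uses edges [v a] and [w c], then
   [a c] is an edge as well, because [v] waits at the deepest possible node. *)
Lemma greedy_match y v :
  y < N -> wt y = S v -> anc par y (bv w) ->
  (forall y2, y2 < N -> wt y2 <> 0 -> anc par y2 (bv w) -> anc par y2 y) ->
  greedy Seen (w :: D) (M ++ [(w, v)]) (upd wt y 0).
Proof.
  intros Hy Hwt Hyb Hnear.
  destruct (g_wt _ _ _ _ G y v Hy Hwt) as (IvD & Etv & Nv).
  destruct (g_lt _ _ _ _ G v IvD) as [Hv Sv]. rewrite Etv in Sv.
  assert (Hvw : w <> v) by congruence.
  assert (Nw : ~ In w (endpoints M)) by (intros H; apply HwD, (g_inc _ _ _ _ G), H).
  assert (Hxb : anc par x (bv w)) by (rewrite <- Hwx; now apply tv_bv).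
  assert (Hxy : anc par x y).
  { apply (late_above x y (bv w)); auto using bv_lt. }
  assert (Ewv : E w v).
  { apply (edge_intro w v y); auto; rewrite ?Hwx, ?Etv; auto.
    - apply anc_refl.
    - rewrite <- Etv. now apply tv_bv. }
  constructor.
  - constructor; auto. apply G.
  - intros u [<-|Hu]; [|now apply G]. split; auto. right. auto.
  - intros u [<-|Hu].
    + left. rewrite endpoints_app, in_app_iff. simpl. auto.
    + rewrite endpoints_app, in_app_iff. simpl.
      destruct (g_cov _ _ _ _ G u Hu) as [H|H]; [auto|].
      unfold upd. destruct (Nat.eqb_spec (tv u) y) as [Eu|]; [|auto].
      rewrite Eu, Hwt in H. injection H as <-. auto.
  - intros y2 v2 Hy2. unfold upd. destruct (Nat.eqb_spec y2 y) as [|Hn]; [discriminate|].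
    intros H2. destruct (g_wt _ _ _ _ G y2 v2 Hy2 H2) as (A1 & A2 & A3).
    split; [now right | split; [auto|]].
    rewrite endpoints_app, in_app_iff. simpl. intros [F|[F|[F|[]]]]; subst; auto.
  - rewrite endpoints_app. apply incl_app; [apply incl_tl, G|].
    simpl. intros u [<-|[<-|[]]]; simpl; auto.
  - intros u1 u2 I1 I2. rewrite endpoints_app, !in_app_iff. simpl. intros N1 N2.
    apply (g_ind _ _ _ _ G); try tauto.
    + destruct I1 as [->|]; tauto.
    + destruct I2 as [->|]; tauto.
  - intros M' HM'. destruct (g_opt _ _ _ _ G M' HM') as (R & [HE HN] & HL).
    rewrite endpoints_app in HN.
    assert (HER : forall a b, In (a, b) R -> E a b)
      by (intros; apply HE, in_app_iff; auto).
    assert (HEM : forall a b, In (a, b) M -> E a b)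
      by (intros; apply HE, in_app_iff; auto).
    (* The new edge [w v] makes up for one lost edge, so [R'] may be one edge shorter than [R], but
       it must avoid [w] and [v]. *)
    enough (exists R', (forall a b, In (a, b) R' -> E a b) /\
      NoDup (endpoints M ++ w :: v :: endpoints R') /\ length R <= S (length R'))
      as (R' & HE' & HN' & HL').
    { exists R'. split; [split|].
      - intros a b H. rewrite !in_app_iff in H. simpl in H.
        destruct H as [[H|[[= <- <-]|[]]]|H]; auto.
      - rewrite !endpoints_app. simpl. rewrite <- app_assoc. exact HN'.
      - rewrite length_app. simpl. lia. }
    destruct (in_dec Nat.eq_dec v (endpoints R)) as [Iv|Iv].
    + destruct (extract_edge E R v edge_sym HER Iv) as (a & R1 & P1 & Eva & L1 & HE1).
      rewrite P1 in HN.
      assert (Na : ~ In a (endpoints M)).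
      { change (v :: a :: endpoints R1) with ([v] ++ a :: endpoints R1) in HN.
        rewrite app_assoc in HN. apply NoDup_remove_2 in HN.
        rewrite !in_app_iff in HN. tauto. }
      destruct (Nat.eq_dec a w) as [->|Naw].
      { exists R1. split; [auto|split; [|lia]]. now rewrite (perm_swap v w). }
      destruct (in_dec Nat.eq_dec w (endpoints R1)) as [Iw|Iw].
      * destruct (extract_edge E R1 w edge_sym HE1 Iw) as (c & R2 & P2 & Ewc & L2 & HE2).
        rewrite P2 in HN.
        assert (Nac : a <> c /\ ~ In c (endpoints M)).
        { change (v :: a :: w :: c :: endpoints R2) with ([v; a; w] ++ c :: endpoints R2) in HN.
          rewrite app_assoc in HN. apply NoDup_remove_2 in HN.
          rewrite !in_app_iff in HN. simpl in HN. split; [intros ->|]; tauto. }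
        destruct Nac as [Nac Nc].
        exists ((a, c) :: R2). split; [|split; [|simpl; lia]].
        -- intros p q [[= <- <-]|H]; auto.
           pose proof Eva as (_ & Ha & _ & z & Hz & [Z1 Z2] & [Z3 Z4]).
           destruct Ewc as (_ & Hc & _ & z2 & Hz2 & [W1 W2] & [W3 W4]).
           rewrite Etv in Z1. rewrite Hwx in W1.
           (* A treated [a] would be an unmatched treated neighbour of [v]. So [a] is untreated, its
              top is not finished, and its path covers everything from [y] up to [x]. *)
           assert (NaD : ~ In a D).
           { intros H. exact (g_ind _ _ _ _ G v a IvD H Nv Na Eva). }
           assert (NFa : ~ Fin (tv a)) by (intros H; apply NaD, Hrem; auto).
           assert (Hay : anc par (tv a) y) by (apply (late_above _ _ z); auto).
           assert (Hya : anc par y (bv a)) by (eapply anc_trans; eauto).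
           assert (Hax : anc par (tv a) x)
             by (apply (late_above _ _ y); auto; now right).
           (* If [c] is treated, it waits at [tv c], an ancestor of [bv w]; as [y] is the deepest
              such node, [tv c] lies between [x] and [y], hence on the path of [a]. *)
           destruct (in_dec Nat.eq_dec c D) as [IcD|IcD].
           ++ destruct (g_cov _ _ _ _ G c IcD) as [?|Wc]; [contradiction|].
              assert (Lc : tv c < N) by (now apply HV).
              assert (Hcb : anc par (tv c) (bv w)) by (eapply anc_trans; eauto).
              assert (Hcy : anc par (tv c) y) by (apply Hnear; auto; lia).
              assert (Sc : Seen (tv c)) by (now apply (g_lt _ _ _ _ G)).
              assert (Hxc : anc par x (tv c))
                by (apply (late_above _ _ (bv w)); auto using bv_lt).
              apply (edge_intro a c (tv c)); auto.
              ** eapply anc_trans; eauto.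
              ** eapply anc_trans; eauto.
              ** apply anc_refl.
              ** now apply tv_bv.
           (* If [c] is untreated, its path starts at or above [x] and meets that of [w], which
              starts at [x]; so it contains [x], as the path of [a] does. *)
           ++ assert (NFc : ~ Fin (tv c)) by (intros H; apply IcD, Hrem; auto).
              assert (Hcx : anc par (tv c) x)
                by (apply (late_above _ _ z2); auto; now right).
              apply (edge_intro a c x); auto;
                [exact (anc_trans _ _ _ _ Hxy Hya) | exact (anc_trans _ _ _ _ W1 W4)].
        -- simpl. revert HN. apply Permutation_NoDup. apply Permutation_app_head.
           rewrite (perm_swap w a). rewrite (perm_swap w v). reflexivity.
      (* Here [w] is free in [R]: dropping the edge [v a] is enough. *)
      * exists R1. split; [auto|split; [|lia]].
        assert (HN' : NoDup ((endpoints M ++ [v]) ++ a :: endpoints R1))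
          by now rewrite <- app_assoc.
        apply NoDup_remove_1 in HN'. rewrite <- app_assoc in HN'. simpl in HN'.
        apply (Permutation_NoDup (l := w :: endpoints M ++ v :: endpoints R1)).
        { apply Permutation_middle. }
        constructor; auto. rewrite in_app_iff. simpl. intuition.
    + destruct (in_dec Nat.eq_dec w (endpoints R)) as [Iw|Iw].
      * destruct (extract_edge E R w edge_sym HER Iw) as (c & R2 & P2 & Ewc & L2 & HE2).
        rewrite P2 in HN. exists R2. split; [auto|split; [|lia]].
        assert (NI : ~ In v (endpoints R2)).
        { intros H. apply Iv. rewrite P2. simpl. auto. }
        assert (HN' : NoDup ((endpoints M ++ [w]) ++ c :: endpoints R2))
          by now rewrite <- app_assoc.
        apply NoDup_remove_1 in HN'. rewrite <- app_assoc in HN'. simpl in HN'.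
        apply (Permutation_NoDup (l := v :: endpoints M ++ w :: endpoints R2)).
        { rewrite (perm_swap v w). apply Permutation_middle. }
        constructor; auto. rewrite in_app_iff. simpl. intuition.
      * exists R. split; [auto|split; [|lia]].
        apply (Permutation_NoDup (l := w :: v :: endpoints M ++ endpoints R)).
        { rewrite <- Permutation_middle. apply perm_skip. apply Permutation_middle. }
        constructor; [|constructor; auto]; simpl; rewrite in_app_iff; intuition.
Qed.

(** A treated unmatched neighbour of [w] would be waiting at its top node, which is an ancestor of
    [bv w]; there is none. The matching is unchanged, so optimality carries over. *)
Lemma greedy_wait :
  (forall y2, y2 < N -> anc par y2 (bv w) -> wt y2 = 0) ->
  greedy Seen (w :: D) M (upd wt x (S w)).
Proof.
  intros Hnone.
  assert (Nw : ~ In w (endpoints M)) by (intros H; apply HwD, (g_inc _ _ _ _ G), H).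
  assert (Wx : wt x = 0).
  { apply Hnone; auto. rewrite <- Hwx. now apply tv_bv. }
  assert (NE : forall u, In u D -> ~ In u (endpoints M) -> ~ E w u).
  { intros u Hu Nu (_ & Hun & _ & z & Hz & [W1 W2] & [W3 W4]).
    destruct (g_cov _ _ _ _ G u Hu) as [?|Wu]; [contradiction|].
    rewrite Hnone in Wu; [discriminate | now apply HV | eapply anc_trans; eauto]. }
  constructor.
  - constructor; auto. apply G.
  - intros u [<-|Hu]; [|now apply G]. split; auto. right. auto.
  - intros u [<-|Hu]; unfold upd.
    + rewrite Hwx, Nat.eqb_refl. auto.
    + destruct (g_cov _ _ _ _ G u Hu) as [H|H]; [auto|right].
      destruct (Nat.eqb_spec (tv u) x) as [Eu|]; [congruence | auto].
  - intros y v Hy. unfold upd. destruct (Nat.eqb_spec y x) as [->|Hn].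
    + intros [= <-]. split; [now left | split; auto].
    + intros H. destruct (g_wt _ _ _ _ G y v Hy H) as (? & ? & ?). simpl. auto.
  - apply incl_tl, G.
  - intros u1 u2 [<-|I1] [<-|I2] N1 N2.
    + intros (_ & _ & F & _). now apply F.
    + auto.
    + intros F. apply edge_sym in F. now apply (NE u1).
    + now apply (g_ind _ _ _ _ G).
  - apply G.
Qed.

(** The root is kept so that every search ends and every deleted node has a parent to be merged
    into. *)
Definition deleted z := Fin z /\ wt z = 0 /\ z <> r.

(** Since [x] is undeleted, [y] lies in the treated subtree of [x]; with nobody waiting it can only
    be [x], or the root, which then equals [x]. Waiting nodes are undeleted, so those above [bv w]
    are ancestors of [y]; when [y] is [x], no proper ancestor has been treated and hence none is
    waited at. *)
Lemma nearest_undeleted y :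
  nearest par deleted (bv w) y -> y < N ->
  anc par y (bv w) /\ Seen y /\
  (wt y = 0 -> y = x /\ forall y2, y2 < N -> anc par y2 (bv w) -> wt y2 = 0) /\
  (wt y <> 0 -> forall y2, y2 < N -> wt y2 <> 0 -> anc par y2 (bv w) -> anc par y2 y).
Proof.
  intros Hn Hy. apply nearest_anc in Hn as (Hyb & Hnd & Hup).
  assert (Hxb : anc par x (bv w)) by (rewrite <- Hwx; now apply tv_bv).
  assert (Hxy : anc par x y).
  { destruct (Hup x Hxb) as [H|[H _]]; auto. contradiction. }
  assert (Sy : Seen y).
  { apply (down_closed _ _ _ HT Seen x y); auto. now right. }
  assert (Rx : y = r -> y = x).
  { intros ->. destruct Hxy as [k <-]. symmetry. eapply iter_root; eauto. }
  split; [auto|split; [auto|split]].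
  - intros Wy.
    assert (Eyx : y = x).
    { destruct Sy as [Fy|]; auto. destruct (Nat.eq_dec y r); auto.
      destruct Hnd. repeat split; auto. }
    split; auto. intros y2 Hy2 H2.
    destruct (wt y2) as [|v2] eqn:W2; auto. exfalso.
    destruct (Hup y2 H2) as [H|(_ & H & _)]; [|congruence].
    rewrite Eyx in H, Wy.
    destruct (waiting_seen y2 v2 Hy2 W2) as [F2 | ->]; [|congruence].
    apply HFx. exact (down_closed _ _ _ HT Fin y2 x HF Hx H F2).
  - intros _ y2 Hy2 W2 H2. destruct (Hup y2 H2) as [H|(_ & H & _)]; auto. contradiction.
Qed.

End Step.
End Greedy.

(** * The matching program *)

Notation vN := 0 (only parsing).
Notation vn := 1 (only parsing).
Notation vhead := 2 (only parsing).
Notation vs := 3 (only parsing).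
Notation vy := 4 (only parsing).
Notation vgo := 5 (only parsing).
Notation vp := 6 (only parsing).
Notation vv := 7 (only parsing).
Notation vx := 8 (only parsing).
Notation vk := 9 (only parsing).
Notation vnode := 10 (only parsing).
Notation vvert := 11 (only parsing).
Notation vq := 12 (only parsing).
Notation va := 13 (only parsing).
Notation vb := 14 (only parsing).
Notation vo := 15 (only parsing).
Notation vc := 16 (only parsing).
Notation vtop := 17 (only parsing).

Notation inp := 0 (only parsing).
Notation vis := 1 (only parsing).
Notation nxt := 2 (only parsing).
Notation hd := 3 (only parsing).
Notation nx := 4 (only parsing).
Notation uf := 5 (only parsing).
Notation sz := 6 (only parsing).
Notation top := 7 (only parsing).
Notation rp := 8 (only parsing).
Notation wt := 9 (only parsing).
Notation out := 10 (only parsing).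

Declare Scope cmd_scope.
Notation "c1 ;; c2" := (CSeq c1 c2) (at level 61, right associativity) : cmd_scope.
Notation "x <- e" := (assign x e) (at level 60, no associativity) : cmd_scope.
Open Scope cmd_scope.

(** Harmless because [vp] is a scratch variable that is not read again after any of its uses. *)
Definition skip : cmd := vp <- Cst 0.

(* Walks up from an unvisited node to a visited one and puts the nodes met in
   front of the list, so that children precede their parents. *)
Definition walk : cmd :=
  whileE (Var vgo) (
    store vis (Var vy) (Cst 1);;
    store sz (Var vy) (Cst 1);;
    store top (Var vy) (Var vy);;
    store rp (Var vy) (Var vy);;
    vp <- Get inp (Add (Cst 3) (Var vy));;
    ifE (Get vis (Var vp))
      (store nxt (Var vy) (Var vhead);; vgo <- Cst 0)
      (store nxt (Var vy) (Add (Var vp) (Cst 1));; vy <- Var vp)).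

Definition order : cmd :=
  vhead <- Cst 0;;
  vs <- Cst 0;;
  whileE (Lt (Var vs) (Var vN)) (
    ifE (Get vis (Var vs)) skip
      (vy <- Var vs;; vgo <- Cst 1;; walk;; vhead <- Add (Var vs) (Cst 1));;
    vs <- Add (Var vs) (Cst 1)).

Definition buckets : cmd :=
  vv <- Cst 0;;
  whileE (Lt (Var vv) (Var vn)) (
    vx <- Get inp (Add (Add (Cst 3) (Var vN)) (Add (Var vv) (Var vv)));;
    store nx (Var vv) (Get hd (Var vx));;
    store hd (Var vx) (Add (Var vv) (Cst 1));;
    vv <- Add (Var vv) (Cst 1)).

(** There is no path compression: union by size alone gives the logarithmic bound. *)
Definition find : cmd :=
  whileE (Get uf (Var vq)) (vq <- Sub (Get uf (Var vq)) (Cst 1)).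

(** [va] is the class root of the node to delete and [vb] that of its parent; the surviving top
    therefore comes from [vb], whichever root survives. *)
Definition link : cmd :=
  vtop <- Get top (Var vb);;
  ifE (Lt (Get sz (Var va)) (Get sz (Var vb)))
    (vo <- Var va;; vc <- Var vb) (vo <- Var vb;; vc <- Var va);;
  store uf (Var vo) (Add (Var vc) (Cst 1));;
  store sz (Var vc) (Add (Get sz (Var vc)) (Get sz (Var vo)));;
  store top (Var vc) (Var vtop);;
  store rp (Var vtop) (Var vc).

(** After a match, [y] hosts nobody and is merged at once, unless it is [x]: further vertices with
    top [x] may still have to wait there, so its fate is decided at the end of the treatment of
    [x]. *)
Definition vertex : cmd :=
  vq <- Get inp (Add (Add (Add (Cst 3) (Var vN)) (Add (Var vv) (Var vv))) (Cst 1));;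
  find;;
  vy <- Get top (Var vq);;
  vp <- Get wt (Var vy);;
  ifE (Var vp)
    (store out (Add (Cst 1) (Add (Var vk) (Var vk))) (Var vv);;
     store out (Add (Cst 2) (Add (Var vk) (Var vk))) (Sub (Var vp) (Cst 1));;
     vk <- Add (Var vk) (Cst 1);;
     store wt (Var vy) (Cst 0);;
     ifE (Eq (Var vy) (Var vx)) skip
       (va <- Get rp (Var vy);;
        vq <- Get inp (Add (Cst 3) (Var vy));;
        find;;
        vb <- Var vq;;
        link))
    (store wt (Var vx) (Add (Var vv) (Cst 1))).

(** The sum in the test acts as a disjunction: [x] is kept if somebody waits there or if it is the
    root. Otherwise [x] and its parent are both undeleted, so [rp] yields their classes without a
    search. *)
Definition main_loop : cmd :=
  vk <- Cst 0;;
  vnode <- Var vhead;;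
  whileE (Var vnode) (
    vx <- Sub (Var vnode) (Cst 1);;
    vvert <- Get hd (Var vx);;
    whileE (Var vvert) (
      vv <- Sub (Var vvert) (Cst 1);;
      vertex;;
      vvert <- Get nx (Var vv));;
    vp <- Get inp (Add (Cst 3) (Var vx));;
    ifE (Add (Get wt (Var vx)) (Eq (Var vp) (Var vx))) skip
      (va <- Get rp (Var vx);; vb <- Get rp (Var vp);; link);;
    vnode <- Get nxt (Var vx));;
  store out (Cst 0) (Var vk).

(** Cell 5 holds the input length [3 + N + 2 * n], from which [N] is recovered. The last assignments
    prepare [copy_out]: the number of output cells, the first index to copy and the increment. *)
Definition solve : cmd :=
  vN <- Sub (Sub (Sub (Var 5) (Cst 3)) (Var vn)) (Var vn);;
  order;;
  buckets;;
  main_loop;;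
  0 <- Get out (Cst 0);;
  1 <- Add (Add (Var 0) (Var 0)) (Cst 1);;
  3 <- Cst K;;
  7 <- Cst 1.

(* Null-terminated linked lists: the reference to [v] is [S v]. *)
Fixpoint lseg (f : nat -> nat) (h : nat) (l : list nat) (e : nat) : Prop :=
  match l with
  | [] => h = e
  | v :: l => h = S v /\ lseg f (f v) l e
  end.

Lemma lseg_ext f g l : forall h e,
  (forall v, In v l -> g v = f v) -> lseg f h l e -> lseg g h l e.
Proof.
  induction l; simpl; intros h e H; auto. intros [-> Hl]. split; auto.
  rewrite H by auto. apply IHl; auto.
Qed.

Lemma lseg_upd f l v a h e : ~ In v l -> lseg f h l e -> lseg (upd f v a) h l e.
Proof.
  intros H. apply lseg_ext. intros u Hu. apply upd_neq. congruence.
Qed.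

Lemma lseg_app f l1 l2 m : forall h e,
  lseg f h l1 m -> lseg f m l2 e -> lseg f h (l1 ++ l2) e.
Proof.
  induction l1; simpl; intros h e; [now intros ->|]. intros [-> H1] H2. split; eauto.
Qed.

Lemma nodup_le (l : list nat) N : NoDup l -> (forall x, In x l -> x < N) -> length l <= N.
Proof.
  intros H1 H2. rewrite <- (length_seq N 0). apply NoDup_incl_length; auto.
  intros x Hx. apply in_seq. specialize (H2 x Hx). lia.
Qed.

(** * Node orders with children before parents *)

Section Topo.
Context (N r : nat) (par : nat -> nat) (HT : rooted_tree N r par).

Fixpoint topo (l : list nat) : Prop :=
  match l with
  | [] => True
  | x :: l => (par x = x \/ In (par x) l) /\ topo l
  end.

Fixpoint chain (l : list nat) (e : nat) : Prop :=
  match l with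
  | [] => True
  | x :: l => par x = match l with [] => e | z :: _ => z end /\ chain l e
  end.

Lemma chain_topo l e L : chain l e -> topo (e :: L) -> topo (l ++ e :: L).
Proof.
  induction l as [|x l IH]; [auto|]. intros [Hx Hl] Ht.
  split; [|now apply IH]. right. destruct l; simpl in *; auto.
Qed.

Lemma chain_rcons l e : chain l e -> chain (l ++ [e]) (par e).
Proof.
  induction l as [|x l IH]; simpl; auto. intros [Hx Hl]. split; [|now apply IH].
  destruct l; auto.
Qed.

Lemma chain_anc l e x : chain l e -> In x l -> anc par e x.
Proof.
  revert x. induction l as [|z l IH]; simpl; [easy|]. intros x [Hz Hl] [<-|Hx]; auto.
  apply anc_par. rewrite Hz. destruct l; [apply anc_refl | apply IH; simpl; auto].
Qed.

(** The parent of a node is the node itself or comes later, so a prefix of the order contains the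
    children of its nodes. This is the closure of [Fin] and [Seen] that the exchange argument
    needs. *)
Lemma topo_closed l1 l2 c :
  topo (l1 ++ l2) -> NoDup (l1 ++ l2) -> In c (l1 ++ l2) -> In (par c) l1 -> In c l1.
Proof.
  induction l1 as [|x l1 IH]; simpl; [easy|].
  intros [Hx Ht] Hn [->|Hc] Hp; [auto|]. right. inversion Hn; subst.
  destruct Hp as [Hp|Hp]; [|apply IH; auto].
  exfalso. apply H1. clear - Ht Hc Hp H1.
  assert (G : forall l, topo l -> In c l -> In (par c) l).
  { induction l as [|z l IHl]; simpl; [easy|]. intros [Hz Hl] [->|H]; auto.
    destruct Hz; auto. }
  rewrite Hp. now apply G.
Qed.
End Topo.

(** * Correctness and cost of the phases *)

Section Phases.
Context (N n r : nat) (par tv bv : nat -> nat).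
Context (HV : valid_rdv N n r par tv bv).
Context (A0 : nat -> nat).
Context (Hpar : forall x, x < N -> A0 (3 + x) = par x).
Context (Htv : forall v, v < n -> A0 (3 + N + (v + v)) = tv v).
Context (Hbv : forall v, v < n -> A0 (3 + N + (v + v) + 1) = bv v).
Context (w C Bd : nat).
Context (HC : K <= C) (HW : C + J * Bd <= 2 ^ w) (HBd : 2 * (3 + N + 2 * n) + 40 <= Bd).
Let HJ : J <= Bd.
Proof. unfold J. lia. Qed.
Let HT : rooted_tree N r par := proj1 HV.

Ltac conj := repeat match goal with |- _ /\ _ => split end.
Ltac ok_tac := cbn [ok ev set Nat.eqb]; unfold CR, J; repeat split; try lia.
Ltac side := try (now vm_compute; lia); try solve [ok_tac].
Ltac step_assign val := eapply (TR_assign w C Bd HC HW HJ _ _ val);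
  [now vm_compute; lia | now vm_compute; lia | side | cbn [ev set Nat.eqb] | cbn [cost]; try lia | cbn [cost set Nat.eqb]].
Ltac step_store idx val := eapply (TR_store w C Bd HC HW HJ _ _ _ idx val);
  [now vm_compute; lia | now vm_compute; lia | now vm_compute; lia | side | side
  | cbn [ev set Nat.eqb] | cbn [ev set Nat.eqb] | try lia | cbn [cost]; try lia | cbn [cost set Nat.eqb]].
Ltac step_if := apply (TR_if w C Bd HC HW HJ);
  [now vm_compute; lia | side | cbn [cost]; try lia
  | cbn [ev set Nat.eqb cost]; intro | cbn [ev set Nat.eqb cost]; intro].

Record visited (A : nat -> nat -> nat) (L : list nat) : Prop := {
  v_nodup : NoDup L;
  v_lt : forall x, In x L -> x < N;
  v_vis : forall x, x < N -> (A vis x <> 0 <-> In x L);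
  v_init : forall x, In x L -> A sz x = 1 /\ A top x = x /\ A rp x = x
}.

Definition frame_order (A A' : nat -> nat -> nat) : Prop :=
  A' inp = A inp /\ A' hd = A hd /\ A' nx = A nx /\ A' uf = A uf /\ A' wt = A wt.

(** The walk inserts [y] between its current path and the old list, hence the permutation. *)
Lemma visited_cons A L L' y A' :
  visited A L -> y < N -> A vis y = 0 -> Permutation (y :: L) L' ->
  A' vis = upd (A vis) y 1 -> A' sz = upd (A sz) y 1 ->
  A' top = upd (A top) y y -> A' rp = upd (A rp) y y -> visited A' L'.
Proof.
  intros [] Hy Hv HP E1 E2 E3 E4.
  assert (Hn : ~ In y L) by (rewrite <- v_vis0; auto).
  assert (HI : forall x, In x L' <-> x = y \/ In x L).
  { intros x. rewrite <- HP. simpl. intuition. }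
  constructor.
  - eapply Permutation_NoDup; [exact HP|]. now constructor.
  - intros x. rewrite HI. intros [->|]; auto.
  - intros x Hx. rewrite E1, HI, <- v_vis0 by auto.
    destruct (Nat.eq_dec x y) as [->|]; [rewrite upd_eq | rewrite upd_neq by auto];
      intuition lia.
  - intros x. rewrite HI, E2, E3, E4. intros H.
    destruct (Nat.eq_dec x y) as [->|]; [rewrite !upd_eq | rewrite !upd_neq by auto]; auto.
    apply v_init0. tauto.
Qed.

(** Time is charged to the newly visited nodes, 100 credits each, which makes all walks together
    linear in [N]. *)
Lemma walk_correct s L R A t (Q : _ -> _ -> _ -> Prop) :
  s < N -> R vs = s -> R vy = s -> R vgo = 1 -> R vhead < Bd ->
  A inp = A0 -> visited A L -> topo par L -> A vis s = 0 ->
  lseg (A nxt) (R vhead) L 0 -> 100 * (N - length L) + 100 <= t ->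
  (forall R' A' t' L', visited A' L' -> topo par L' -> In s L' -> incl L L' ->
     lseg (A' nxt) (S s) L' 0 -> t <= t' + 100 * (length L' - length L) + 10 ->
     R' vN = R vN -> R' vn = R vn -> R' vs = s -> frame_order A A' -> Q R' A' t') ->
  TR w C walk R A t Q.
Proof.
  intros Hs Rs Ry Rgo Rh HA HL Htopo Hvs Hseg Ht HQ.
  (* Either the walk stands at an unvisited node, with the path [l] below it not yet linked to the
     old list, or the two lists have been joined. *)
  apply (TR_while w C Bd HC HW HJ) with (I := fun R' A' t' =>
    R' vN = R vN /\ R' vn = R vn /\ R' vs = s /\ R' vhead = R vhead /\ frame_order A A' /\
    ((R' vgo = 1 /\ exists l, R' vy < N /\ visited A' (l ++ L) /\ A' vis (R' vy) = 0 /\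
        lseg (A' nxt) (S s) l (S (R' vy)) /\ lseg (A' nxt) (R vhead) L 0 /\
        chain par l (R' vy) /\ In s (l ++ [R' vy]) /\ t <= t' + 100 * length l) \/
     (R' vgo = 0 /\ exists L', visited A' L' /\ topo par L' /\ In s L' /\ incl L L' /\
        lseg (A' nxt) (S s) L' 0 /\ t <= t' + 100 * (length L' - length L)))).
  - conj; auto. { unfold frame_order; auto. }
    left. split; auto. exists []. rewrite Ry. simpl. conj; auto; lia.
  - now vm_compute; lia.
  - intros R' A' t' (E1 & E2 & E3 & E4 & F & H).
    split; [ok_tac|]. cbn [ev cost].
    destruct H as [(Eg & l & Hy & Hv & Hvy & Hl & HsL & Hch & Hin & Ht') |
      (Eg & L' & Hv & Htp & Hin & Hinc & Hsg & Ht')].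
    2: { pose proof (nodup_le L' N (v_nodup _ _ Hv) (v_lt _ _ Hv)).
         split; [lia|]. split; [|lia]. intros _. apply (HQ R' A' _ L'); auto; lia. }
    set (y := R' vy) in *.
    assert (Hny : ~ In y (l ++ L)) by (rewrite <- (v_vis _ _ Hv); auto; lia).
    assert (Hlen : S (length l + length L) <= N).
    { rewrite <- length_app. apply (nodup_le (y :: l ++ L)).
      - constructor; auto. apply Hv.
      - intros x [<-|Hx]; auto. now apply (v_lt _ _ Hv). }
    assert (Hin0 : A' inp = A0) by (rewrite (proj1 F); auto).
    split; [lia|]. split; [lia|]. intros _.
    apply TR_seq. step_store y 1; auto; try lia.
    apply TR_seq. step_store y 1; auto; try lia.
    apply TR_seq. step_store y y; auto; try lia.
    apply TR_seq. step_store y y; auto; try lia.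
    apply TR_seq. step_assign (par y). { rewrite Hin0. now apply Hpar. }
    assert (Hp : par y < N) by now apply (par_lt N r par HT).
    assert (HP : Permutation (y :: l ++ L) (l ++ y :: L)) by apply Permutation_middle.
    destruct F as (F1 & F2 & F3 & F4 & F5).
    step_if.
    (* A marked parent is the root just marked, being its own parent, or lies in the old list; on
       the path [l] it would be a descendant of [y] and close a cycle. *)
    + assert (Hpy : par y = y \/ In (par y) L).
      { destruct (Nat.eq_dec (par y) y) as [|Hne]; [auto|right].
        rewrite upd_neq in H by auto. apply (v_vis _ _ Hv) in H; auto.
        apply in_app_iff in H as [H|H]; auto. exfalso. apply Hne.
        apply (anc_antisym N r par HT); auto.
        - exists 1. reflexivity.
        - eapply chain_anc; eauto. }
      apply TR_seq. step_store y (R vhead); auto; try lia.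
      step_assign 0; auto; try lia.
      conj; auto. { unfold frame_order; cbn [set Nat.eqb]; auto 10. }
      right. split; auto. exists (l ++ y :: L).
      split; [apply (visited_cons _ _ _ _ _ Hv Hy Hvy HP); reflexivity|].
      cbn [set Nat.eqb].
      split; [apply chain_topo; auto; simpl; auto|].
      split; [apply in_app_iff in Hin as [|[<-|[]]]; apply in_app_iff; simpl; auto|].
      split; [apply incl_appr, incl_tl, incl_refl|].
      split; [|rewrite length_app; simpl; lia].
      apply (lseg_app _ _ _ (S y)).
      * apply lseg_upd; auto. intros F. apply Hny, in_app_iff; auto.
      * split; auto. rewrite upd_eq. apply lseg_upd; auto.
        intros F. apply Hny, in_app_iff; auto.
    + assert (Hne : par y <> y) by (intros E; rewrite E, upd_eq in H; discriminate).
      apply TR_seq. step_store y (S (par y)); auto; try lia.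
      step_assign (par y); auto; try lia.
      conj; auto. { unfold frame_order; cbn [set Nat.eqb]; auto 10. }
      left. split; auto. exists (l ++ [y]). cbn [set Nat.eqb].
      split; auto. split.
      { apply (visited_cons _ _ _ _ _ Hv Hy Hvy); try reflexivity.
        now rewrite <- app_assoc. }
      split; [auto|]. split.
      { apply (lseg_app _ _ _ (S y)).
        - apply lseg_upd; auto. intros F. apply Hny, in_app_iff; auto.
        - simpl. now rewrite upd_eq. }
      split.
      { apply lseg_upd; auto. intros F. apply Hny, in_app_iff; auto. }
      split; [now apply chain_rcons|].
      split; [apply in_app_iff; auto|]. rewrite length_app. simpl. lia.
Qed.

Lemma order_correct R A t (Q : _ -> _ -> _ -> Prop) :
  R vN = N -> A inp = A0 -> (forall x, A vis x = 0) -> 200 * N + 50 <= t ->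
  (forall R' A' t' L, NoDup L -> (forall x, In x L <-> x < N) -> topo par L ->
     lseg (A' nxt) (R' vhead) L 0 -> R' vhead < Bd ->
     (forall x, x < N -> A' sz x = 1 /\ A' top x = x /\ A' rp x = x) ->
     t <= t' + 200 * N + 50 -> R' vN = N -> R' vn = R vn -> frame_order A A' ->
     Q R' A' t') ->
  TR w C order R A t Q.
Proof.
  intros RN HA Hvis Ht HQ.
  apply TR_seq. step_assign 0; auto.
  apply TR_seq. step_assign 0; auto.
  (* Starting positions are charged apart from visited nodes, since a start may already have been
     visited by an earlier walk. *)
  apply (TR_while w C Bd HC HW HJ) with (I := fun R' A' t' =>
    R' vN = N /\ R' vn = R vn /\ R' vhead < Bd /\ R' vs <= N /\ frame_order A A' /\
    exists L, visited A' L /\ topo par L /\ lseg (A' nxt) (R' vhead) L 0 /\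
      (forall x, x < R' vs -> In x L) /\ t <= t' + 100 * length L + 100 * R' vs + 10).
  - cbn [set Nat.eqb]. conj; auto; try lia. { unfold frame_order; auto. }
    exists []. conj; simpl; auto; try lia.
    constructor; simpl; try easy; [constructor|]. intros x _. now rewrite Hvis.
  - now vm_compute; lia.
  - intros R' A' t' (E1 & E2 & E3 & E4 & F & L & HL & Htp & Hsg & Hlt & Ht').
    assert (HlenL : length L <= N) by (apply nodup_le; apply HL).
    split; [ok_tac|]. cbn [ev cost]. split; [lia|].
    destruct (Nat.ltb_spec (R' vs) (R' vN)) as [Hs|Hs]; rewrite E1 in Hs;
      (split; [try discriminate|try congruence]); intros _.
    + assert (HA' : A' inp = A0) by (rewrite (proj1 F); auto).
      apply TR_seq. step_if.
      * step_assign 0; auto; try lia.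
        step_assign (S (R' vs)); auto; try lia.
        conj; auto; try lia. exists L. conj; auto; cbn [set Nat.eqb]; [|lia].
        intros x Hx. destruct (Nat.eq_dec x (R' vs)) as [->|].
        -- apply (v_vis _ _ HL); auto.
        -- apply Hlt; lia.
      * apply TR_seq. step_assign (R' vs); auto; try lia.
        apply TR_seq. step_assign 1; auto; try lia.
        apply TR_seq. apply (walk_correct (R' vs) L); cbn [set Nat.eqb]; auto; try lia.
        intros R2 A2 t2 L2 HL2 Htp2 Hin2 Hinc2 Hsg2 Ht2 G1 G2 G3 F2.
        assert (HlenL2 : length L <= length L2 <= N).
        { split; [apply NoDup_incl_length; auto; apply HL | apply nodup_le; apply HL2]. }
        step_assign (S (R' vs)); auto; try lia.
        step_assign (S (R' vs)); auto; try lia.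
        conj; auto; try lia.
        { unfold frame_order in *. intuition congruence. }
        exists L2. cbn [set Nat.eqb]. conj; auto; try lia.
        intros x Hx. destruct (Nat.eq_dec x (R' vs)) as [->|]; auto.
        apply Hinc2, Hlt; lia.
    + assert (HI : forall x, In x L <-> x < N).
      { intros x. split; [apply HL|]. intros. apply Hlt; lia. }
      apply (HQ R' A' _ L); auto; try lia.
      * apply HL.
      * intros x Hx. now apply (v_init _ _ HL), HI.
Qed.

Lemma buckets_correct R A t (Q : _ -> _ -> _ -> Prop) :
  R vN = N -> R vn = n -> A inp = A0 -> (forall x, A hd x = 0) -> 100 * n + 50 <= t ->
  (forall R' A' t' bk, (forall x, x < N -> lseg (A' nx) (A' hd x) (bk x) 0 /\
       NoDup (bk x) /\ forall v, In v (bk x) <-> v < n /\ tv v = x) ->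
     t <= t' + 100 * n + 50 -> R' vN = N -> R' vn = n -> R' vhead = R vhead ->
     (forall j, j <> hd -> j <> nx -> A' j = A j) -> Q R' A' t') ->
  TR w C buckets R A t Q.
Proof.
  intros RN Rn HA Hhd Ht HQ.
  apply TR_seq. step_assign 0; auto.
  apply (TR_while w C Bd HC HW HJ) with (I := fun R' A' t' =>
    R' vN = N /\ R' vn = n /\ R' vhead = R vhead /\ R' vv <= n /\
    (forall j, j <> hd -> j <> nx -> A' j = A j) /\
    (exists bk, forall x, x < N -> lseg (A' nx) (A' hd x) (bk x) 0 /\
       NoDup (bk x) /\ forall v, In v (bk x) <-> v < R' vv /\ tv v = x) /\
    t <= t' + 100 * R' vv + 10).
  - cbn [set Nat.eqb]. conj; auto; try lia.
    exists (fun _ => []). intros x Hx. rewrite Hhd. simpl.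
    split; auto. split; [constructor|]. intros v. lia.
  - now vm_compute; lia.
  - intros R' A' t' (E1 & E2 & E3 & E4 & F & (bk & Hbk) & Ht').
    split; [ok_tac|]. cbn [ev cost]. split; [lia|].
    destruct (Nat.ltb_spec (R' vv) (R' vn)) as [Hs|Hs]; rewrite E2 in Hs;
      (split; [try discriminate|try congruence]); intros _.
    + assert (Ltv : tv (R' vv) < N) by now apply HV.
      assert (HA' : A' inp = A0) by (rewrite F; auto).
      apply TR_seq. step_assign (tv (R' vv)).
      { rewrite HA', E1. now apply Htv. }
      apply TR_seq. step_store (R' vv) (A' hd (tv (R' vv))); auto; try lia.
      apply TR_seq. step_store (tv (R' vv)) (S (R' vv)); auto; try lia.
      step_assign (S (R' vv)); auto; try lia.
      conj; auto; try lia.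
      { intros j J1 J2. rewrite <- (F j) by auto. unfold set.
        apply Nat.eqb_neq in J1, J2. now rewrite J1, J2. }
      exists (fun x => if x =? tv (R' vv) then R' vv :: bk x else bk x).
      intros x Hx. cbn [set Nat.eqb]. destruct (Hbk x Hx) as (B1 & B2 & B3).
      assert (NI : ~ In (R' vv) (bk x)) by (rewrite B3; lia).
      unfold upd at 2. destruct (Nat.eqb_spec x (tv (R' vv))) as [->|Hn].
      * split; [|split].
        -- split; auto. rewrite upd_eq. now apply lseg_upd.
        -- now constructor.
        -- intros v. simpl. rewrite B3. split; [intros [<-|]; lia|].
           destruct (Nat.eq_dec (R' vv) v); [auto|]. intros. right. lia.
      * split; [now apply lseg_upd | split; auto].
        intros v. rewrite B3. split; [lia|]. intros [Hv <-]. split; auto.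
        destruct (Nat.eq_dec v (R' vv)) as [->|]; [congruence|lia].
    + replace (R' vv) with n in * by lia. apply (HQ R' A' _ bk); auto; lia.
Qed.

(** Ranks strictly increase along the pointers, so the rank of the current node pays for the steps
    made so far, 30 credits each. *)
Lemma find_correct Del u s' tp rp' rt rk z R A t (Q : _ -> _ -> _ -> Prop) :
  dsu_ghost N par Del u s' tp rp' rt rk -> A uf = u -> z < N -> R vq = z ->
  30 * Nat.log2 N + 30 <= t ->
  (forall R' t', R' vq = rt z -> (forall i, i <> vq -> R' i = R i) ->
     t <= t' + 30 * Nat.log2 N + 30 -> Q R' A t') ->
  TR w C find R A t Q.
Proof.
  intros G HA Hz Rq Ht HQ.
  apply (TR_while w C Bd HC HW HJ) with (I := fun R' A' t' =>
    A' = A /\ R' vq < N /\ rt (R' vq) = rt z /\ (forall i, i <> vq -> R' i = R i) /\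
    t <= t' + 30 * rk (R' vq)).
  - rewrite Rq. conj; auto; lia.
  - now vm_compute; lia.
  - intros R' A' t' (-> & Hq & Hr & F & Ht').
    pose proof (dsu_rank _ _ _ _ _ _ _ _ _ _ G Hq) as Hk.
    split; [ok_tac|]. cbn [ev cost]. split; [lia|]. rewrite HA. split; intros E.
    + apply HQ; auto; [|lia]. rewrite <- Hr. symmetry. now apply G.
    + destruct (u (R' vq)) as [|q] eqn:Eq; [congruence|].
      destruct (d_step _ _ _ _ _ _ _ _ _ G (R' vq) q Hq Eq) as (L & Hrq & Hlt).
      step_assign q.
      * ok_tac; rewrite HA, Eq; lia.
      * rewrite HA, Eq. lia.
      * conj; auto; try lia; try congruence. 
        -- intros i Hi. unfold set. apply Nat.eqb_neq in Hi. rewrite Hi. apply F.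
           now apply Nat.eqb_neq.
Qed.


Lemma link_correct (Del Del' : nat -> Prop) rt rk y R A t (Q : _ -> _ -> _ -> Prop) :
  dsu_ghost N par Del (A uf) (A sz) (A top) (A rp) rt rk ->
  y < N -> ~ Del y -> y <> r -> (forall x, Del' x <-> Del x \/ x = y) ->
  R va = rt y -> R vb = rt (par y) -> 150 <= t ->
  (forall R' A' t', dsu N par Del' (A' uf) (A' sz) (A' top) (A' rp) ->
     (forall i, i < vo -> R' i = R i) ->
     (forall j, j < uf \/ rp < j -> A' j = A j) -> t <= t' + 150 -> Q R' A' t') ->
  TR w C link R A t Q.
Proof.
  intros G Hy Hd Hr HD Ra Rb Ht HQ.
  assert (Hp : par y < N) by now apply (par_lt N r par HT).
  destruct (d_root _ _ _ _ _ _ _ _ _ G y Hy) as [La Ua].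
  destruct (d_root _ _ _ _ _ _ _ _ _ G _ Hp) as [Lb Ub].
  destruct (d_top _ _ _ _ _ _ _ _ _ G _ Hp) as [Lt _].
  set (a := rt y) in *. set (b := rt (par y)) in *.
  assert (Sa : A sz a <= N) by (eapply dsu_size; eauto).
  assert (Sb : A sz b <= N) by (eapply dsu_size; eauto).
  (* The stores common to both outcomes of the size comparison. *)
  assert (Hfin : forall o c R A2 t2, o = a /\ c = b \/ o = b /\ c = a ->
    A sz o <= A sz c -> R vo = o -> R vc = c -> R vtop = A top b -> A2 = A ->
    t <= t2 + 60 -> (forall R' A' t', dsu N par Del' (A' uf) (A' sz) (A' top) (A' rp) ->
      R' = R -> (forall j, j < uf \/ rp < j -> A' j = A j) -> t2 <= t' + 60 -> Q R' A' t') ->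
    TR w C (store uf (Var vo) (Add (Var vc) (Cst 1));;
      store sz (Var vc) (Add (Get sz (Var vc)) (Get sz (Var vo)));;
      store top (Var vc) (Var vtop);; store rp (Var vtop) (Var vc)) R A2 t2 Q).
  { clear R Ra Rb HQ. intros o c R A2 t2 Hoc Hs Ro Rc Rt -> Ht2 HQ.
    assert (Lo : o < N) by (destruct Hoc as [[-> ->]|[-> ->]]; auto).
    assert (Lc : c < N) by (destruct Hoc as [[-> ->]|[-> ->]]; auto).
    assert (So : A sz o <= N) by (destruct Hoc as [[-> ->]|[-> ->]]; auto).
    assert (Sc : A sz c <= N) by (destruct Hoc as [[-> ->]|[-> ->]]; auto).
    apply TR_seq. step_store o (S c); auto; try lia.
    apply TR_seq. step_store c (A sz c + A sz o); try (rewrite ?Ro, ?Rc; lia); auto.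
    { ok_tac; rewrite ?Ro, ?Rc; lia. }
    apply TR_seq. step_store c (A top b); auto; try lia.
    step_store (A top b) c; auto; try lia.
    apply HQ; cbn [set Nat.eqb]; auto; [|intros j Hj|lia].
    - apply (dsu_link N r par HT Del Del' _ _ _ _ rt rk y a b); auto.
    - rewrite !set_neq by lia. reflexivity. }
  apply TR_seq. step_assign (A top b); auto; try lia.
  apply TR_seq. step_if.
  - rewrite Ra, Rb in H. destruct (Nat.ltb_spec (A sz a) (A sz b)); [|lia].
    apply TR_seq. step_assign a; auto; try lia.
    step_assign b; auto; try lia.
    apply (Hfin a b); auto; try lia. intros R' A' t' HD' -> HA' Ht'.
    apply HQ; auto; try lia.
    intros i Hi. rewrite !set_neq by lia. reflexivity.
  - rewrite Ra, Rb in H. destruct (Nat.ltb_spec (A sz a) (A sz b)); [lia|].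
    apply TR_seq. step_assign b; auto; try lia.
    step_assign a; auto; try lia.
    apply (Hfin b a); auto; try lia. intros R' A' t' HD' -> HA' Ht'.
    apply HQ; auto; try lia.
    intros i Hi. rewrite !set_neq by lia. reflexivity.
Qed.

Definition written (A : nat -> nat -> nat) (M : list (nat * nat)) : Prop :=
  forall i, i < length M -> nth_error M i = Some (A out (1 + 2 * i), A out (2 + 2 * i)).

(** For [greedy] the node [x] already counts as seen, while for [deleted] it is not finished: it
    must remain available to the rest of its vertices. *)
Record state (Fin : nat -> Prop) (x : nat) (D : list nat) (M : list (nat * nat))
  (R : nat -> nat) (A : nat -> nat -> nat) : Prop := {
  s_N : R vN = N;
  s_n : R vn = n;
  s_k : R vk = length M;
  s_inp : A inp = A0;
  s_out : written A M;
  s_greedy : greedy N n par tv bv (fun z => Fin z \/ z = x) D M (A wt);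
  s_dsu : dsu N par (deleted r Fin (A wt)) (A uf) (A sz) (A top) (A rp)
}.

Lemma written_snoc A A' M v u :
  written A M ->
  A' out = upd (upd (A out) (1 + (length M + length M)) v) (2 + (length M + length M)) u ->
  written A' (M ++ [(v, u)]).
Proof.
  intros H E i Hi. rewrite E. rewrite length_app in Hi. simpl in Hi.
  destruct (Nat.eq_dec i (length M)) as [->|].
  - rewrite nth_error_app2, Nat.sub_diag by lia. cbn [nth_error]. f_equal. f_equal.
    + rewrite upd_neq by lia. replace (length M + length M) with (2 * length M) by lia.
      now rewrite upd_eq.
    + replace (length M + length M) with (2 * length M) by lia. now rewrite upd_eq.
  - rewrite nth_error_app1 by lia. rewrite !upd_neq by lia. apply H. lia.
Qed.

Section Node.
Context (Fin : nat -> Prop) (x : nat).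
Context (Hx : x < N) (HFx : ~ Fin x).
Context (HF : forall c, c < N -> Fin (par c) -> Fin c).
Context (HS : forall c, c < N -> Fin (par c) \/ par c = x -> Fin c \/ c = x).

(** The two possible searches, from [bv v] and from the parent of the node set free, account for
    [60 * Nat.log2 N]. *)
Lemma vertex_correct v D M R A t (Q : _ -> _ -> _ -> Prop) :
  state Fin x D M R A -> (forall v, v < n -> Fin (tv v) -> In v D) ->
  v < n -> ~ In v D -> tv v = x -> R vv = v -> R vx = x ->
  60 * Nat.log2 N + 400 <= t ->
  (forall R' A' t' M', state Fin x (v :: D) M' R' A' ->
     R' vv = v -> R' vx = x -> R' vnode = R vnode ->
     A' nxt = A nxt -> A' hd = A hd -> A' nx = A nx ->
     t <= t' + 60 * Nat.log2 N + 400 -> Q R' A' t') ->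
  TR w C vertex R A t Q.
Proof.
  intros [HN Hn Hk HA Hout G HD] Hrem Hv HvD Htx Rv Rx Ht HQ.
  destruct HD as (rt & rk & HD).
  assert (Lb : bv v < N) by now apply HV.
  assert (HM : 2 * length M <= n) by exact (greedy_size _ _ _ _ _ _ _ _ _ G).
  apply TR_seq. step_assign (bv v).
  { rewrite HA, HN, Rv. now apply Hbv. }
  apply TR_seq. apply (find_correct _ _ _ _ _ rt rk (bv v) _ _ _ _ HD); auto; try lia.
  intros R1 t1 Q1 F1 Ht1.
  assert (F1' : forall i, i <> vq -> R1 i = R i).
  { intros i Hi. rewrite F1, set_neq; auto. }
  clear F1. rename F1' into F1.
  destruct (d_root _ _ _ _ _ _ _ _ _ HD (bv v) Lb) as [Lr Ur].
  destruct (d_top _ _ _ _ _ _ _ _ _ HD (bv v) Lb) as [Ly Ny].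
  set (y := A top (rt (bv v))) in *.
  destruct (nearest_undeleted N n r par tv bv HV Fin x Hx HFx HF HS D M (A wt) v G
    Hv Htx y Ny Ly) as (Hyb & Sy & Hzero & Hpos).
  apply TR_seq. step_assign y; auto; try lia.
  { now rewrite Q1. }
  apply TR_seq. step_assign (A wt y); auto; try lia.
  step_if.
  - specialize (Hpos H). destruct (A wt y) as [|u] eqn:Wy; [congruence|].
    destruct (g_wt _ _ _ _ _ _ _ _ _ G y u Ly Wy) as (Iu & Htu & Nu).
    assert (Lu : u < n) by (now apply (g_lt _ _ _ _ _ _ _ _ _ G)).
    assert (G' := greedy_match N n r par tv bv HV Fin x Hx HFx HF HS D M (A wt) v G
      Hrem Hv HvD Htx y u Ly Wy Hyb Hpos).
    apply TR_seq. step_store (1 + (length M + length M)) v; try (rewrite ?F1; lia);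
      try (ok_tac; rewrite ?F1; lia).
    apply TR_seq. step_store (2 + (length M + length M)) u; try (rewrite ?F1; lia);
      try (ok_tac; rewrite ?F1; lia).
    apply TR_seq. step_assign (length M + 1); try (rewrite ?F1; lia);
      try (ok_tac; rewrite ?F1; lia).
    apply TR_seq. step_store y 0; auto; try lia.
    step_if.
    + destruct (Nat.eqb_spec y (R1 vx)) as [E|]; [|congruence].
      rewrite F1, Rx in E by lia.
      step_assign 0; auto; try lia.
      apply (HQ _ _ _ (M ++ [(v, u)])); cbn [set Nat.eqb]; rewrite ?F1 by lia; auto; try lia.
      constructor; cbn [set Nat.eqb]; rewrite ?F1 by lia; auto.
      * rewrite length_app. reflexivity.
      * eapply written_snoc; [exact Hout | reflexivity].
      (* [x] is not finished, so clearing its entry does not change the deleted set. *)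
      * apply (dsu_ext _ _ (deleted r Fin (A wt))); [|now exists rt, rk].
        intros z. unfold deleted. destruct (Nat.eq_dec z y) as [->|Hz].
        -- rewrite upd_eq, Wy, E. intuition.
        -- now rewrite upd_neq.
    + destruct (Nat.eqb_spec y (R1 vx)) as [|E]; [discriminate|].
      rewrite F1, Rx in E by lia.
      assert (Fy : Fin y) by (destruct Sy; [auto|contradiction]).
      (* A finished root would force all nodes, and so [x], to be finished. *)
      assert (Hyr : y <> r).
      { intros ->. apply HFx. apply (down_closed N r par HT Fin r x); auto.
        apply HT. exact Hx. }
      assert (Hyd : ~ deleted r Fin (A wt) y) by (unfold deleted; lia).
      assert (Ry : A rp y = rt y) by (now apply (d_rp _ _ _ _ _ _ _ _ _ HD)).
      assert (Lp : par y < N) by (now apply (par_lt N r par HT)).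
      destruct (d_root _ _ _ _ _ _ _ _ _ HD y Ly) as [Lry _].
      destruct (d_root _ _ _ _ _ _ _ _ _ HD _ Lp) as [Lrp _].
      apply TR_seq. step_assign (rt y); auto; try lia.
      apply TR_seq. step_assign (par y); auto; try lia.
      { rewrite HA. now apply Hpar. }
      apply TR_seq.
      apply (find_correct _ _ _ _ _ rt rk (par y) _ _ _ _ HD); auto; try lia.
      intros R2 t2 Q2 F2 Ht2.
      assert (G2 : R2 va = rt y) by (rewrite F2 by lia; reflexivity).
      assert (F2' : forall i, i < 12 -> i <> 4 -> i <> 6 -> i <> 9 -> R2 i = R i).
      { intros i ? ? ? ?. rewrite F2, !set_neq by lia. apply F1. lia. }
      assert (K2 : R2 vk = length M + 1) by (rewrite F2 by lia; reflexivity).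
      clear F2. apply TR_seq. step_assign (rt (par y)); auto; try lia.
      apply (link_correct (deleted r Fin (A wt)) (deleted r Fin (upd (A wt) y 0))
        rt rk y); auto; try lia.
      * intros z. unfold deleted. destruct (Nat.eq_dec z y) as [->|Hz].
        -- rewrite upd_eq. intuition.
        -- rewrite upd_neq by auto. intuition.
      * intros R3 A3 t3 D3 F3 B3 Ht3.
        apply (HQ _ _ _ (M ++ [(v, u)]));
          try (rewrite F3 by lia; cbn [set Nat.eqb]; rewrite F2' by lia; auto; fail);
          try (rewrite B3 by lia; reflexivity); try lia.
        constructor; try (rewrite F3 by lia; cbn [set Nat.eqb]; rewrite F2' by lia; auto; fail).
        -- rewrite F3 by lia. cbn [set Nat.eqb]. rewrite K2, length_app. reflexivity.
        -- rewrite B3 by lia. exact HA.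
        -- eapply written_snoc; [exact Hout | rewrite B3 by lia; reflexivity].
        -- rewrite B3 by lia. exact G'.
        -- rewrite B3 by lia. exact D3.
  - destruct (Hzero H) as [Eyx Hnone].
    assert (G' := greedy_wait N n r par tv bv HV Fin x Hx D M (A wt) v G
      Hv HvD Htx Hnone).
    step_store x (S v); try (rewrite ?F1; lia); try (ok_tac; rewrite ?F1; lia).
    apply (HQ _ _ _ M); cbn [set Nat.eqb]; rewrite ?F1 by lia; auto; try lia.
    constructor; cbn [set Nat.eqb]; rewrite ?F1 by lia; auto.
    apply (dsu_ext _ _ (deleted r Fin (A wt))); [|now exists rt, rk].
    intros z. unfold deleted. destruct (Nat.eq_dec z x) as [->|Hz]; [intuition|].
    now rewrite upd_neq.
Qed.
End Node.

(** Each node pays 300 credits, and each vertex [cV]: its treatment plus the overhead of the inner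
    loop. *)
Lemma main_loop_correct L bk R A t (Q : _ -> _ -> _ -> Prop) :
  R vN = N -> R vn = n -> A inp = A0 ->
  NoDup L -> (forall x, In x L <-> x < N) -> topo par L ->
  lseg (A nxt) (R vhead) L 0 ->
  (forall x, x < N -> lseg (A nx) (A hd x) (bk x) 0 /\
     NoDup (bk x) /\ forall v, In v (bk x) <-> v < n /\ tv v = x) ->
  (forall x, x < N -> A uf x = 0 /\ A sz x = 1 /\ A top x = x /\ A rp x = x) ->
  (forall x, x < N -> A wt x = 0) ->
  300 * N + (60 * Nat.log2 N + 500) * n + 100 <= t ->
  (forall R' A' t' M, A' out 0 = length M -> written A' M ->
     2 * length M <= n -> is_maximum_matching (rdv_edge N n par tv bv) M ->
     t <= t' + 300 * N + (60 * Nat.log2 N + 500) * n + 100 -> Q R' A' t') ->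
  TR w C main_loop R A t Q.
Proof.
  intros RN Rn HA HLn HLi Htp Hsg Hbk Hini Hwt Ht HQ.
  set (cV := 60 * Nat.log2 N + 500) in *.
  assert (HLlen : length L <= N) by (apply nodup_le; auto; intros; now apply HLi).
  apply TR_seq. step_assign 0; auto.
  apply TR_seq. step_assign (R vhead); auto.
  apply TR_seq.
  apply (TR_while w C Bd HC HW HJ) with (I := fun R' A' t' =>
    R' vN = N /\ R' vn = n /\ A' inp = A0 /\ A' nxt = A nxt /\ A' hd = A hd /\
    A' nx = A nx /\ exists l1 l2 D M, L = l1 ++ l2 /\ lseg (A nxt) (R' vnode) l2 0 /\
    R' vk = length M /\ written A' M /\
    greedy N n par tv bv (fun z => In z l1) D M (A' wt) /\
    dsu N par (deleted r (fun z => In z l1) (A' wt)) (A' uf) (A' sz) (A' top) (A' rp) /\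
    (forall v, In v D <-> v < n /\ In (tv v) l1) /\
    t <= t' + 300 * length l1 + cV * length D + 10).
  { cbn [set Nat.eqb]. conj; auto.
    exists [], L, [], []. conj; auto; try (simpl; lia).
    - intros i Hi. simpl in Hi. lia.
    - apply greedy_init; auto.
    - eapply dsu_ext; [|apply dsu_init, Hini]. unfold deleted. simpl. tauto. }
  { now vm_compute; lia. }
  intros R' A' t' (E1 & E2 & E3 & E4 & E5 & E6 & l1 & l2 & D & M & -> & Hl2 & Hk & Hwr &
    G & HD & HDi & Ht').
  assert (HDn : length D <= n).
  { apply nodup_le; [apply G|]. intros v Hv. now apply HDi. }
  assert (cV * length D <= cV * n) by now apply Nat.mul_le_mono_l.
  rewrite length_app in HLlen.
  split; [ok_tac|]. cbn [ev cost]. split; [lia|]. split; intros Hnode.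
  { destruct l2 as [|x l2]; [|destruct Hl2; lia].
    rewrite app_nil_r in *. simpl in HLlen.
    assert (HM : 2 * length M <= n) by exact (greedy_size _ _ _ _ _ _ _ _ _ G).
    step_store 0 (length M); auto; try lia.
    apply (HQ _ _ _ M); cbn [set Nat.eqb]; auto; try lia.
    apply (greedy_final _ _ _ _ _ _ _ _ _ G). intros v Hv. apply HDi. split; auto.
      apply HLi. now apply HV. }
  destruct l2 as [|x l2]; [simpl in Hl2; congruence|]. destruct Hl2 as [Hx Hl2].
  simpl in HLlen.
  assert (Lx : x < N) by (apply HLi, in_app_iff; simpl; auto).
  assert (HFx : ~ In x l1).
  { apply NoDup_remove_2 in HLn. rewrite in_app_iff in HLn. tauto. }
  assert (HF : forall c, c < N -> In (par c) l1 -> In c l1).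
  { intros c Hc Hp. apply (topo_closed par l1 (x :: l2)); auto. now apply HLi. }
  assert (HS : forall c, c < N -> In (par c) l1 \/ par c = x -> In c l1 \/ c = x).
  { intros c Hc Hp.
    assert (I : In c (l1 ++ [x])); [|apply in_app_iff in I; simpl in I; intuition].
    apply (topo_closed par _ l2); rewrite <- ?app_assoc; auto; [now apply HLi|].
    apply in_app_iff. simpl. intuition. }
  destruct (Hbk x Lx) as (B1 & B2 & B3).
  apply TR_seq. step_assign x; auto; try lia.
  apply TR_seq. step_assign (A hd x); auto; try lia.
  { now rewrite E5. }
  apply TR_seq.
  (* [l] holds the vertices of the bucket still to be treated; [l1] plays the part of [Fin]. *)
  apply (TR_while w C Bd HC HW HJ) with (I := fun R' A' t' =>
    A' nxt = A nxt /\ A' hd = A hd /\ A' nx = A nx /\ R' vx = x /\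
    exists l D M, lseg (A nx) (R' vvert) l 0 /\ NoDup l /\
    state (fun z => In z l1) x D M R' A' /\
    (forall v, In v l -> v < n /\ tv v = x) /\
    (forall v, In v D <-> v < n /\ (In (tv v) l1 \/ tv v = x /\ ~ In v l)) /\
    t <= t' + 300 * length l1 + 50 + cV * length D + 10).
  { cbn [set Nat.eqb]. conj; auto. exists (bk x), D, M. conj; auto; try lia.
    - constructor; auto. eapply greedy_weaken; [|exact G]. simpl. auto.
    - intros v. now apply B3.
    - intros v. rewrite HDi, B3. intuition congruence. }
  { now vm_compute; lia. }
  clear R' A' t' E1 E2 E3 E4 E5 E6 D M Hk Hwr G HD HDi Ht' Hnode Hx HDn H.
  intros R' A' t' (E4 & E5 & E6 & Ex & l & D & M & Hl & Hln & HSt & Hlx & HDi & Ht').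
  pose proof (s_greedy _ _ _ _ _ _ HSt) as G.
  assert (HDn : length D <= n).
  { apply nodup_le; [apply G|]. intros v Hv. now apply HDi. }
  assert (cV * length D <= cV * n) by now apply Nat.mul_le_mono_l.
  split; [ok_tac|]. cbn [ev cost]. split; [lia|]. split; intros Hvert.
  - destruct l as [|v l]; [|destruct Hl; lia].
    assert (HDi' : forall v, In v D <-> v < n /\ In (tv v) (l1 ++ [x])).
    { intros v. rewrite HDi, in_app_iff. simpl. intuition. }
    clear Hl Hln Hlx HDi.
    destruct HSt as [HN Hn Hk HA' Hwr _ HD].
    assert (HWx : A' wt x <= n).
    { destruct (A' wt x) as [|v] eqn:E; [lia|].
      destruct (g_wt _ _ _ _ _ _ _ _ _ G x v Lx E) as (I & _). apply HDi' in I. lia. }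
    apply TR_seq. step_assign (par x).
    { rewrite HA', Ex. now apply Hpar. }
    assert (G' : greedy N n par tv bv (fun z => In z (l1 ++ [x])) D M (A' wt)).
    { eapply greedy_weaken; [|exact G]. intros z. rewrite in_app_iff. simpl. intuition. }
    assert (Hl1x : length (l1 ++ [x]) = S (length l1)) by (rewrite length_app; simpl; lia).
    apply TR_seq. step_if.
    { ok_tac. rewrite Ex. destruct (_ =? _); lia. }
    (* Finishing [x] does not delete it here: somebody waits at [x] or it is the root. *)
    + assert (HD' : dsu N par (deleted r (fun z => In z (l1 ++ [x])) (A' wt))
        (A' uf) (A' sz) (A' top) (A' rp)).
      { eapply dsu_ext; [|exact HD]. intros z. unfold deleted. rewrite in_app_iff. simpl.
        rewrite Ex in H0. destruct (Nat.eqb_spec (par x) x) as [E|E].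
        - apply (par_fix N r par HT) in E; auto. intuition congruence.
        - assert (A' wt x <> 0) by lia. intuition congruence. }
      step_assign 0; auto; try lia.
      step_assign (A nxt x); auto; try lia.
      { now rewrite E4, Ex. }
      conj; auto. exists (l1 ++ [x]), l2, D, M. rewrite <- app_assoc.
      conj; auto. rewrite Hl1x. lia.
    + rewrite Ex in H0. destruct (Nat.eqb_spec (par x) x) as [E|E]; [lia|].
      assert (Lp : par x < N) by (now apply (par_lt N r par HT)).
      destruct HD as (rt & rk & HD).
      destruct (d_root _ _ _ _ _ _ _ _ _ HD x Lx) as [Lrx _].
      destruct (d_root _ _ _ _ _ _ _ _ _ HD _ Lp) as [Lrp _].
      assert (Rx : A' rp x = rt x).
      { apply (d_rp _ _ _ _ _ _ _ _ _ HD); auto. unfold deleted. tauto. }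
      assert (Rp : A' rp (par x) = rt (par x)).
      { apply (d_rp _ _ _ _ _ _ _ _ _ HD); auto. intros (F & _). auto. }
      apply TR_seq. step_assign (rt x); auto; try lia.
      { now rewrite Ex. }
      apply TR_seq. step_assign (rt (par x)); auto; try lia.
      apply (link_correct (deleted r (fun z => In z l1) (A' wt))
        (deleted r (fun z => In z (l1 ++ [x])) (A' wt)) rt rk x); auto; try lia.
      * unfold deleted. tauto.
      * intros ->. apply E. apply HT.
      * intros z. unfold deleted. rewrite in_app_iff. simpl.
        assert (x <> r) by (intros ->; apply E; apply HT).
        split; [intuition|]. intros [?| ->]; [intuition|]. conj; auto. lia.
      * intros R3 A3 t3 D3 F3 W3 Ht3.
        assert (F8 : R3 vx = x) by (rewrite F3 by lia; exact Ex).
        step_assign (A nxt x); auto; try lia.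
        { rewrite W3, E4, F8 by lia. reflexivity. }
        cbn [set Nat.eqb]. rewrite !F3, !W3 by lia. cbn [set Nat.eqb].
        conj; auto. exists (l1 ++ [x]), l2, D, M. rewrite <- app_assoc.
        conj; auto; [|lia].
        intros i Hi. rewrite W3 by lia. now apply Hwr.
  - destruct l as [|v l]; [simpl in Hl; congruence|]. destruct Hl as [Hv Hl].
    destruct (Hlx v (or_introl eq_refl)) as [Lv Tv].
    assert (HvD : ~ In v D) by (rewrite HDi, Tv; simpl; intuition).
    assert (HDn' : S (length D) <= n).
    { apply (nodup_le (v :: D)); [constructor; auto; apply G|].
      intros u [<-|Hu]; auto. now apply HDi. }
    assert (cV * S (length D) <= cV * n) by now apply Nat.mul_le_mono_l.
    apply NoDup_cons_iff in Hln as [Hvl Hln'].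
    apply TR_seq. step_assign v; auto; try lia.
    apply TR_seq. apply (vertex_correct (fun z => In z l1) x Lx HFx HF HS v D M);
      cbn [set Nat.eqb]; auto; try lia.
    + destruct HSt. constructor; auto.
    + intros u Lu Fu. apply HDi. auto.
    + intros R3 A3 t3 M3 HSt3 Rv3 Rx3 _ N3 H3 X3 Ht3.
      step_assign (A nx v); auto; try lia.
      { now rewrite X3, E6, Rv3. }
      cbn [set Nat.eqb]. conj; try congruence.
      exists l, (v :: D), M3. conj; auto; try (simpl; lia).
      * destruct HSt3. constructor; auto.
      * intros u Hu. apply Hlx. now right.
      * intros u. simpl. rewrite HDi. simpl.
        destruct (Nat.eq_dec v u) as [->|]; intuition.
Qed.

(** The budget adds up the phases: 500 = 200 + 300 per node and 600 = 100 + 500 per vertex. *)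
Lemma solve_correct R A t (Q : _ -> _ -> _ -> Prop) :
  R 5 = 3 + N + 2 * n -> R vn = n -> A inp = A0 ->
  (forall j i, 0 < j < J -> A j i = 0) ->
  500 * N + (60 * Nat.log2 N + 600) * n + 300 <= t ->
  (forall R' A' t' M, R' 1 = 2 * length M + 1 -> R' 3 = K -> R' 7 = 1 ->
     A' out 0 = length M -> written A' M -> 2 * length M <= n ->
     is_maximum_matching (rdv_edge N n par tv bv) M ->
     t <= t' + 500 * N + (60 * Nat.log2 N + 600) * n + 300 -> Q R' A' t') ->
  TR w C solve R A t Q.
Proof.
  intros R5 Rn HA Hz Ht HQ. assert (HJ16 : J = 16) by reflexivity.
  assert (HK : K = 32) by reflexivity.
  apply TR_seq. step_assign N; auto; try lia.
  apply TR_seq. eapply order_correct; cbn [set Nat.eqb]; auto; try lia.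
  { intros x. apply Hz. lia. }
  intros R1 A1 t1 L HLn HLi Htp Hsg _ Hini Ht1 N1 n1 (F0 & F3 & F4 & F5 & F9).
  apply TR_seq. eapply buckets_correct; auto; try lia; try congruence.
  { intros x. rewrite F3. apply Hz. lia. }
  intros R2 A2 t2 bk Hbk Ht2 N2 n2 H2 F2.
  apply TR_seq. apply (main_loop_correct L bk); auto; try lia.
  { rewrite F2 by lia. congruence. }
  { rewrite F2, H2 by lia. exact Hsg. }
  { intros x Hx. rewrite !F2, F5 by lia. rewrite Hz by lia.
    split; [reflexivity | now apply Hini]. }
  { intros x Hx. rewrite F2, F9 by lia. apply Hz. lia. }
  intros R3 A3 t3 M HM0 HMw HMn HMm Ht3.
  apply TR_seq. step_assign (length M); auto; try lia.
  apply TR_seq. step_assign (2 * length M + 1); auto; try lia.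
  apply TR_seq. step_assign K; auto; try lia.
  step_assign 1; auto; try lia.
  apply (HQ _ _ _ M); auto; lia.
Qed.

End Phases.

(** * Moving the input and the output *)

(* The input occupies the cells of the registers.  With [C] in cell 0 and [n]
   in cell 1, and [r] being redundant, cell 2 suffices to move it away. *)
Fixpoint saves (a k : nat) : cmd :=
  match k with
  | 0 => CI (IConst 2 0)
  | S k => CI (IConst 2 (J * a));; CI (IBin OAdd 2 0 2);; CI (IStore 2 a);; saves (S a) k
  end.

(** Sources lie below [C] and destinations at or above it, so no cell is overwritten before it is
    read. *)
Definition copy_in : cmd :=
  CWhile (CI (IBin OLt 4 3 5)) 4 (
    CI (IConst 4 J);; CI (IBin OMul 4 3 4);; CI (IBin OAdd 4 4 0);;
    CI (ILoad 6 3);; CI (IStore 4 6);; CI (IBin OAdd 3 3 7)).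

(** Computing [C] in cell 0 destroys [N]; the input length [C - K], kept in cell 5, preserves the
    information. *)
Definition prologue : cmd :=
  CI (IConst 2 3);; CI (IBin OAdd 0 0 2);; CI (IBin OAdd 0 0 1);; CI (IBin OAdd 0 0 1);;
  CI (IConst 2 K);; CI (IBin OAdd 0 0 2);;
  saves 3 (K - 3);;
  CI (IConst 5 K);; CI (IBin OSub 5 0 5);; CI (IConst 3 K);; CI (IConst 7 1);;
  copy_in;;
  CI (IBin OOr CR 0 0).

(** Starts at index [K]: lower entries belong into the cells of the registers, which are still in
    use here. The output is too short to reach the arrays. *)
Definition copy_out : cmd :=
  CWhile (CI (IBin OLt 4 3 1)) 4 (
    CI (IConst 4 J);; CI (IBin OMul 4 3 4);; CI (IBin OAdd 4 4 CR);;
    CI (IConst 5 out);; CI (IBin OAdd 4 4 5);;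
    CI (ILoad 6 4);; CI (IStore 3 6);; CI (IBin OAdd 3 3 7)).

(** Goes downwards because cell 0 holds the base address and cell 2 is scratch; cell 0 comes last,
    loaded through itself. *)
Fixpoint loads (k : nat) : cmd :=
  match k with
  | 0 => CI (IConst 2 (J * 2));; CI (IBin OAdd 2 0 2);; CI (ILoad 2 2);;
         CI (IConst 1 (J * 1));; CI (IBin OAdd 1 0 1);; CI (ILoad 1 1);; CI (ILoad 0 0)
  | S k => CI (IConst 2 (J * (k + 3)));; CI (IBin OAdd 2 0 2);; CI (ILoad (k + 3) 2);;
           loads k
  end.

Definition epilogue : cmd :=
  CI (IBin OOr 0 CR CR);; CI (IConst 2 out);; CI (IBin OAdd 0 0 2);; loads (K - 3).

Definition matching_cmd : cmd := prologue;; solve;; copy_out;; epilogue.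

(** * Correctness of the data movement *)

Section Raw.
Context (w : nat).

Ltac raw := intros; apply tr_instr; auto; unfold effect; cbn [step snd eval_binop].

Lemma tr_const d k m t (Q : _ -> _ -> Prop) :
  k < 2 ^ w -> 1 <= t -> Q (upd m d k) (t - 1) -> tr w (CI (IConst d k)) m t Q.
Proof. raw. now rewrite Nat.mod_small. Qed.

Lemma tr_add d a b v m t (Q : _ -> _ -> Prop) :
  m a + m b = v -> v < 2 ^ w -> 1 <= t -> Q (upd m d v) (t - 1) ->
  tr w (CI (IBin OAdd d a b)) m t Q.
Proof. raw. rewrite Nat.mod_small; congruence. Qed.

Lemma tr_mul d a b v m t (Q : _ -> _ -> Prop) :
  m a * m b = v -> v < 2 ^ w -> 1 <= t -> Q (upd m d v) (t - 1) ->
  tr w (CI (IBin OMul d a b)) m t Q.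
Proof. raw. rewrite Nat.mod_small; congruence. Qed.

Lemma tr_sub d a b v m t (Q : _ -> _ -> Prop) :
  m a = m b + v -> v < 2 ^ w -> 1 <= t -> Q (upd m d v) (t - 1) ->
  tr w (CI (IBin OSub d a b)) m t Q.
Proof.
  raw. replace (2 ^ w + m a - m b) with (v + 1 * 2 ^ w) by lia.
  rewrite Nat.Div0.mod_add, Nat.mod_small; auto.
Qed.

Lemma tr_move d a v m t (Q : _ -> _ -> Prop) :
  m a = v -> 1 <= t -> Q (upd m d v) (t - 1) -> tr w (CI (IBin OOr d a a)) m t Q.
Proof. raw. rewrite Nat.lor_diag. congruence. Qed.

Lemma tr_load d a x v m t (Q : _ -> _ -> Prop) :
  m a = x -> m x = v -> 1 <= t -> Q (upd m d v) (t - 1) -> tr w (CI (ILoad d a)) m t Q.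
Proof. raw. congruence. Qed.

Lemma tr_store a s x v m t (Q : _ -> _ -> Prop) :
  m a = x -> m s = v -> 1 <= t -> Q (upd m x v) (t - 1) -> tr w (CI (IStore a s)) m t Q.
Proof. raw. congruence. Qed.

Lemma tr_lt_while d a b c (I Q : (nat -> nat) -> nat -> Prop) m t :
  I m t ->
  (forall m t, I m t -> 3 <= t /\
    (m b <= m a -> Q (upd m d 0) (t - 2)) /\
    (m a < m b -> tr w c (upd m d 1) (t - 3) I)) ->
  tr w (CWhile (CI (IBin OLt d a b)) d c) m t Q.
Proof.
  intros Hi H. apply tr_while with (I := I); auto. clear m t Hi.
  intros m t Hi. destruct (H m t Hi) as (Ht & H0 & H1).
  apply tr_instr; auto; [lia|]. unfold effect; cbn [step snd eval_binop].
  rewrite upd_eq. split; [lia|].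
  destruct (Nat.ltb_spec (m a) (m b)); (split; [intros|intros]); try congruence; try lia.
  - replace (t - 1 - 2) with (t - 3) by lia. auto.
  - replace (t - 1 - 1) with (t - 2) by lia. auto.
Qed.

Context (C : nat) (HC : K <= C) (HW : C + J * K < 2 ^ w).

Lemma saves_correct k : forall a m t (Q : _ -> _ -> Prop),
  3 <= a -> a + k <= K -> m 0 = C -> 3 * k + 1 <= t ->
  (forall m', (forall i, a <= i < a + k -> m' (C + J * i) = m i) ->
     (forall x, x <> 2 -> (forall i, a <= i < a + k -> x <> C + J * i) -> m' x = m x) ->
     Q m' (t - (3 * k + 1))) ->
  tr w (saves a k) m t Q.
Proof.
  assert (HJ : J = 16) by reflexivity. assert (HK : K = 32) by reflexivity.
  induction k as [|k IH]; intros a m t Q Ha Hk H0 Ht HQ; cbn [saves].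
  - apply tr_const; [lia | lia |]. apply HQ; [lia|].
    intros x Hx _. now apply upd_neq.
  - apply tr_seq, tr_const; [nia | lia |].
    apply tr_seq, tr_add with (v := C + J * a); [upds; lia | nia | lia |].
    apply tr_seq, tr_store with (x := C + J * a) (v := m a); [upds; lia | upds; lia | lia |].
    apply IH; [lia | lia | upds; lia | lia |].
    intros m' H1 H2.
    replace (t - 1 - 1 - 1 - (3 * k + 1)) with (t - (3 * S k + 1)) by lia.
    apply HQ.
    + intros i Hi. destruct (Nat.eq_dec i a) as [->|Hn].
      * rewrite H2; [upds; auto | lia | nia].
      * rewrite H1 by lia. upds. auto.
    + intros x Hx Hi. rewrite H2; auto.
      * rewrite upd_neq by (apply Hi; lia). upds. auto.
      * intros i Hi'. apply Hi. lia.
Qed.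

Lemma copy_in_correct B mi m t (Q : _ -> _ -> Prop) :
  C = B + K -> C + J * B < 2 ^ w ->
  m 0 = C -> m 3 = K -> m 5 = B -> m 7 = 1 ->
  (forall x, K <= x < C -> m x = mi x) ->
  (forall i, 3 <= i < K -> m (C + J * i) = mi i) ->
  (forall x, C <= x -> (forall i, 3 <= i < K -> x <> C + J * i) -> m x = mi x) ->
  10 * B + 10 <= t ->
  (forall m' t', m' 0 = C -> m' 1 = m 1 -> m' 5 = B ->
     (forall i, 3 <= i < B -> m' (C + J * i) = mi i) ->
     (forall i j, 0 < j < J -> m' (C + J * i + j) = mi (C + J * i + j)) ->
     t <= t' + 10 * B + 10 -> Q m' t') ->
  tr w copy_in m t Q.
Proof.
  assert (HJ : J = 16) by reflexivity. assert (HK : K = 32) by reflexivity.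
  intros EC HW' H0 H3 H5 H7 Hlow Hsv Hrest Ht HQ.
  apply tr_lt_while with (I := fun m' t' =>
    exists a, K <= a /\ m' 0 = C /\ m' 1 = m 1 /\ m' 3 = a /\ m' 5 = B /\ m' 7 = 1 /\
    (forall x, K <= x < C -> m' x = mi x) /\
    (forall i, 3 <= i < a -> m' (C + J * i) = mi i) /\
    (forall x, C <= x -> (forall i, 3 <= i < a -> x <> C + J * i) -> m' x = mi x) /\
    t + 10 * K <= t' + 10 * a /\ (a = K \/ a <= B)).
  (* For an input shorter than [K] cells the loop does not run, hence the alternative [a = K] in the
     invariant. *)
  { exists K. repeat split; auto; lia. }
  clear H0 H3 H5 H7 Hlow Hsv Hrest.
  intros m' t' (a & Ka & H0 & H1 & H3 & H5 & H7 & Hlow & Hsv & Hrest & Ht' & Ha).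
  split; [lia|]. rewrite H3, H5. split; intros Hab.
  - apply HQ; upds; auto; [| |lia].
    + intros i Hi. upds. apply Hsv. lia.
    + intros i j Hj. upds. apply Hrest; [lia|]. intros i' _. nia.
  - apply tr_seq, tr_const; [nia | lia |].
    apply tr_seq, tr_mul with (v := J * a); [upds; lia | nia | lia |].
    apply tr_seq, tr_add with (v := C + J * a); [upds; lia | nia | lia |].
    apply tr_seq, tr_load with (x := a) (v := mi a); [upds; auto | upds; apply Hlow; lia | lia |].
    apply tr_seq, tr_store with (x := C + J * a) (v := mi a); [upds; auto | upds; auto | lia |].
    apply tr_add with (v := a + 1); [upds; lia | nia | lia |].
    exists (a + 1). upds. repeat split; auto; try lia.
    + intros x Hx. upds. now apply Hlow.
    + intros i Hi. destruct (Nat.eq_dec i a) as [->|Hn]; upds; auto. apply Hsv. lia.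
    + intros x Hx Hi. pose proof (Hi a ltac:(lia)). upds. apply Hrest; auto. intros i Hi'. apply Hi. lia.
Qed.

Lemma copy_out_correct (o : nat -> nat) e m t (Q : _ -> _ -> Prop) :
  e <= C -> C + J * e + J < 2 ^ w ->
  m CR = C -> m 1 = e -> m 3 = K -> m 7 = 1 -> (forall i, m (C + J * i + out) = o i) ->
  12 * e + 10 <= t ->
  (forall m' t', m' CR = C -> (forall i, m' (C + J * i + out) = o i) ->
     (forall i, K <= i < e -> m' i = o i) -> t <= t' + 12 * e + 10 -> Q m' t') ->
  tr w copy_out m t Q.
Proof.
  assert (HJ : J = 16) by reflexivity. assert (HK : K = 32) by reflexivity.
  assert (HCR : CR = 20) by reflexivity.
  intros He HW' HR H1 H3 H7 Ho Ht HQ.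
  apply tr_lt_while with (I := fun m' t' =>
    exists a, K <= a /\ m' CR = C /\ m' 1 = e /\ m' 3 = a /\ m' 7 = 1 /\
    (forall i, m' (C + J * i + out) = o i) /\ (forall i, K <= i < a -> m' i = o i) /\
    t + 12 * K <= t' + 12 * a /\ (a = K \/ a <= e)).
  { exists K. repeat split; auto; lia. }
  clear H1 H3 H7 Ho.
  intros m' t' (a & Ka & H0 & H1 & H3 & H7 & Ho & Hc & Ht' & Ha).
  split; [lia|]. rewrite H1, H3. split; intros Hae.
  - apply HQ; upds; auto; [| |lia].
    + intros i. upds. auto.
    + intros i Hi. upds. apply Hc. lia.
  - apply tr_seq, tr_const; [nia | lia |].
    apply tr_seq, tr_mul with (v := J * a); [upds; lia | nia | lia |].
    apply tr_seq, tr_add with (v := C + J * a); [upds; lia | nia | lia |].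
    apply tr_seq, tr_const; [nia | lia |].
    apply tr_seq, tr_add with (v := C + J * a + out); [upds; lia | nia | lia |].
    apply tr_seq, tr_load with (x := C + J * a + out) (v := o a); [upds; auto | upds; auto | lia |].
    apply tr_seq, tr_store with (x := a) (v := o a); [upds; auto | upds; auto | lia |].
    apply tr_add with (v := a + 1); [upds; lia | nia | lia |].
    exists (a + 1). upds. repeat split; auto; try lia.
    + intros i. upds. auto.
    + intros i Hi. destruct (Nat.eq_dec i a) as [->|Hn]; upds; auto. apply Hc. lia.
Qed.

Lemma loads_correct (o : nat -> nat) k : forall m t (Q : _ -> _ -> Prop),
  k + 3 <= K -> C + out + J * K < 2 ^ w ->
  m 0 = C + out -> (forall i, m (C + out + J * i) = o i) -> 3 * k + 7 <= t ->
  (forall m' t', (forall i, i < k + 3 -> m' i = o i) ->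
     (forall i, k + 3 <= i -> m' i = m i) -> Q m' t') ->
  tr w (loads k) m t Q.
Proof.
  assert (HJ : J = 16) by reflexivity. assert (HK : K = 32) by reflexivity.
  induction k as [|k IH]; intros m t Q Hk HW' H0 Ho Ht HQ; cbn [loads].
  - apply tr_seq, tr_const; [nia | lia |].
    apply tr_seq, tr_add with (v := C + out + J * 2); [upds; lia | nia | lia |].
    apply tr_seq, tr_load with (x := C + out + J * 2) (v := o 2); [upds; auto | upds; auto | lia |].
    apply tr_seq, tr_const; [nia | lia |].
    apply tr_seq, tr_add with (v := C + out + J * 1); [upds; lia | nia | lia |].
    apply tr_seq, tr_load with (x := C + out + J * 1) (v := o 1); [upds; auto | upds; auto | lia |].
    apply tr_load with (x := C + out + J * 0) (v := o 0); [upds; lia | upds; auto | lia |].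
    apply HQ.
    + intros i Hi. destruct i as [|[|[|i]]]; upds; auto. lia.
    + intros i Hi. upds. auto.
  - apply tr_seq, tr_const; [nia | lia |].
    apply tr_seq, tr_add with (v := C + out + J * (k + 3)); [upds; lia | nia | lia |].
    apply tr_seq, tr_load with (x := C + out + J * (k + 3)) (v := o (k + 3)); [upds; auto | upds; auto | lia |].
    apply IH; [lia | lia | upds; lia | | lia |].
    + intros i. upds. auto.
    + intros m' t' H1 H2. apply HQ.
      * intros i Hi. destruct (Nat.eq_dec i (k + 3)) as [->|]; [|apply H1; lia].
        rewrite H2 by lia. upds. auto.
      * intros i Hi. rewrite H2 by lia. upds. auto.
Qed.

End Raw.

(** With [h] half of [log2 N]: if [n <= 2 ^ h], about the square root of [N], then [n * log2 N] is
    at most [2 ^ h * (2 * 2 ^ h) <= 2 * N]. Otherwise [log2 n >= h], and [2 * h + 1 <= 3 * h] for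
    positive [h] gives the factor 3. *)
Lemma log_bound N n : 1 <= N -> n * Nat.log2 N <= 3 * (N + n * Nat.log2 n).
Proof.
  intros HN. set (l := Nat.log2 N).
  assert (HlN : 2 ^ l <= N) by now apply Nat.log2_spec.
  set (h := l / 2).
  assert (Hh : l <= 2 * h + 1).
  { pose proof (Nat.div_mod_eq l 2). pose proof (Nat.mod_upper_bound l 2). unfold h. lia. }
  assert (H2h : 2 ^ h * 2 ^ h <= N).
  { rewrite <- Nat.pow_add_r. transitivity (2 ^ l); auto. apply Nat.pow_le_mono_r; auto.
    pose proof (Nat.div_mod_eq l 2). unfold h. lia. }
  destruct (le_lt_dec n (2 ^ h)) as [Hn|Hn].
  - pose proof (Nat.pow_gt_lin_r 2 h ltac:(lia)).
    assert (l <= 2 * 2 ^ h) by lia. nia.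
  - assert (h <= Nat.log2 n) by (apply Nat.log2_le_pow2; lia).
    destruct (Nat.eq_dec h 0) as [E|E].
    + assert (1 <= Nat.log2 n).
      { apply Nat.log2_le_pow2; [lia|]. rewrite E in Hn. simpl in Hn. simpl. lia. }
      nia.
    + nia.
Qed.

Lemma linear_bound N n : 1 <= N -> n <= N + n * Nat.log2 n.
Proof.
  intros HN. destruct (le_lt_dec n 1); [lia|].
  assert (1 <= Nat.log2 n) by (apply Nat.log2_le_pow2; simpl; lia). nia.
Qed.

(** * Assembly of the program and its time bound *)

Lemma run_end p w f m : run p w f (length p) m = Some m.
Proof.
  assert (E : nth_error p (length p) = None) by now apply nth_error_None.
  destruct f; cbn [run]; now rewrite E.
Qed.

Lemma prologue_correct N n r par tv bv w t (Q : _ -> _ -> Prop) :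
  let B := 3 + N + 2 * n in
  let C := B + K in
  let m := input_mem N n r par tv bv in
  1000 * B <= 2 ^ w -> 10 * B + 200 <= t ->
  (forall m' t', m' CR = C -> m' 1 = n -> m' 5 = B ->
     (forall i, 3 <= i < B -> m' (C + J * i) = m i) ->
     (forall i j, 0 < j < J -> m' (C + J * i + j) = 0) ->
     t <= t' + 10 * B + 200 -> Q m' t') ->
  tr w prologue m t Q.
Proof.
  intros B C m HW Ht HQ.
  assert (HJ : J = 16) by reflexivity. assert (HK : K = 32) by reflexivity.
  assert (HCR : CR = 20) by reflexivity.
  assert (M0 : m 0 = N) by reflexivity. assert (M1 : m 1 = n) by reflexivity.
  assert (Mend : forall x, B <= x -> m x = 0).
  { intros x Hx. unfold m, input_mem.
    destruct (Nat.eqb_spec x 0); [lia|]. destruct (Nat.eqb_spec x 1); [lia|].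
    destruct (Nat.eqb_spec x 2); [lia|]. destruct (Nat.ltb_spec x (3 + N)); [lia|].
    destruct (Nat.ltb_spec x (3 + N + 2 * n)); [lia|]. reflexivity. }
  clearbody m. unfold prologue.
  apply tr_seq, tr_const; [lia | lia |].
  apply tr_seq, tr_add with (v := N + 3); [upds; lia | lia | lia |].
  apply tr_seq, tr_add with (v := N + 3 + n); [upds; lia | lia | lia |].
  apply tr_seq, tr_add with (v := B); [upds; lia | lia | lia |].
  apply tr_seq, tr_const; [lia | lia |].
  apply tr_seq, tr_add with (v := C); [upds; lia | lia | lia |].
  apply tr_seq, (saves_correct w C); [lia | lia | lia | lia | upds; lia | lia |].
  intros m1 H1 H2.
  assert (E0 : m1 0 = C) by (rewrite H2 by lia; upds; auto).
  assert (E1 : m1 1 = n) by (rewrite H2 by lia; upds; auto).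
  apply tr_seq, tr_const; [lia | lia |].
  apply tr_seq, tr_sub with (v := B); [upds; lia | lia | lia |].
  apply tr_seq, tr_const; [lia | lia |].
  apply tr_seq, tr_const; [lia | lia |].
  apply tr_seq, (copy_in_correct w C) with (B := B) (mi := m); upds; auto; try lia.
  - intros x Hx. upds. rewrite H2 by lia. upds. auto.
  - intros i Hi. upds. rewrite H1 by lia. upds. auto.
  - intros x Hx Hi. upds. rewrite H2; [upds; auto | lia |].
    intros i Hi'. apply Hi. lia.
  - intros m2 t2 F0 F1 F5 Fs Fr Ht2.
    apply tr_move with (v := C); [auto | lia |].
    apply HQ; upds; auto; try lia.
    + intros i Hi. upds. auto.
    + intros i j Hj. upds. rewrite Fr by auto. apply Mend. lia.
Qed.

Lemma input_par N n r par tv bv x : x < N -> input_mem N n r par tv bv (3 + x) = par x.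
Proof.
  intros Hx. unfold input_mem. replace (3 + x <? 3 + N) with true.
  - simpl. f_equal. lia.
  - symmetry. apply Nat.ltb_lt. lia.
Qed.

Lemma input_ends N n r par tv bv v : v < n ->
  input_mem N n r par tv bv (3 + N + (v + v)) = tv v /\
  input_mem N n r par tv bv (3 + N + (v + v) + 1) = bv v.
Proof.
  intros Hv.
  assert (E : forall k, k < 2 * n -> input_mem N n r par tv bv (3 + N + k) =
    if Nat.even k then tv (k / 2) else bv (k / 2)).
  { intros k Hk. unfold input_mem.
    replace (3 + N + k =? 0) with false by reflexivity.
    replace (3 + N + k =? 1) with false by reflexivity.
    replace (3 + N + k =? 2) with false by reflexivity.
    replace (3 + N + k <? 3 + N) with false by (symmetry; apply Nat.ltb_ge; lia).
    replace (3 + N + k <? 3 + N + 2 * n) with true by (symmetry; apply Nat.ltb_lt; lia).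
    replace (3 + N + k - (3 + N)) with k by lia. reflexivity. }
  split.
  - rewrite E by lia. replace (v + v) with (2 * v) by lia.
    rewrite Nat.even_mul. simpl orb. cbn iota. f_equal. rewrite Nat.mul_comm.
    now apply Nat.div_mul.
  - rewrite <- Nat.add_assoc. rewrite E by lia. replace (v + v + 1) with (2 * v + 1) by lia.
    replace (Nat.even (2 * v + 1)) with false
      by (rewrite Nat.even_add, Nat.even_mul; reflexivity).
    f_equal.
    symmetry. apply (Nat.div_unique _ 2 v 1); lia.
Qed.

Theorem theorem3 :
  exists (p : program) (c d : nat),
    forall (N n r : nat) (par tv bv : nat -> nat),
      valid_rdv N n r par tv bv ->
      forall w : nat, d * (3 + N + 2 * n) <= 2 ^ w ->
        exists (m : nat -> nat) (M : list (nat * nat)),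
          run p w (c * (N + n * Nat.log2 n)) 0 (input_mem N n r par tv bv)
            = Some m /\
          output_is m M /\
          is_maximum_matching (rdv_edge N n par tv bv) M.
Proof.
  (* 4000 covers all phase budgets after [n * log2 N] is replaced by its bound and additive
     constants are absorbed by [1 <= N]. 1000 leaves room for every address, as [C + J * Bd] is
     about 33 times the input length plus a constant. *)
  exists (compile 0 matching_cmd), 4000, 1000.
  intros N n r par tv bv HV w HW.
  assert (HJ : J = 16) by reflexivity. assert (HK : K = 32) by reflexivity.
  assert (HCR : CR = 20) by reflexivity.
  assert (HN : 1 <= N) by (destruct HV as [[H _] _]; lia).
  (* The factor 2 in [Bd] allows for the sum of two class sizes, and 40 for constants such as
     [K]. *)
  set (B := 3 + N + 2 * n) in *. set (C := B + K). set (Bd := 2 * B + 40).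
  pose proof (log_bound N n HN) as HL. pose proof (linear_bound N n HN) as HL2.
  set (t := 4000 * (N + n * Nat.log2 n)).
  set (mi := input_mem N n r par tv bv).
  set (lg := Nat.log2 N) in *. set (X := N + n * Nat.log2 n) in *.
  assert (Ht : 600 * N + (60 * lg + 700) * n + 40 * B + 2000 <= t) by (unfold t, B; lia).
  clearbody t. clear HL HL2.
  enough (tr w matching_cmd mi t (fun m _ => exists M, output_is m M /\
    is_maximum_matching (rdv_edge N n par tv bv) M))
    as (m' & k & Hex & Hk & M & Hout & HM).
  { exists m', M. split; auto.
    replace t with (k + (t - k)) by lia.
    rewrite (exec_run _ _ _ _ _ Hex).
    - rewrite <- (length_compile matching_cmd 0). apply run_end.
    - exists [], []. rewrite app_nil_r. auto. }
  assert (HC : K <= C) by (unfold C; lia).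
  assert (HWb : C + J * Bd <= 2 ^ w) by (unfold C, Bd, B in *; lia).
  assert (HBd : 2 * (3 + N + 2 * n) + 40 <= Bd) by (unfold Bd, B; lia).
  assert (HJB : J <= Bd) by (unfold Bd; lia).
  unfold matching_cmd.
  apply tr_seq, prologue_correct; auto; fold B C mi; [lia|].
  intros m1 t1 R20 R1 R5 Hin Hz Ht1.
  set (A := fun j i => m1 (C + J * i + j)).
  assert (HA : forall i, 3 <= i < B -> A 0 i = mi i).
  { intros i Hi. unfold A. rewrite Nat.add_0_r. now apply Hin. }
  assert (Hrep : rep C m1 A m1) by (repeat split; auto).
  apply tr_seq. eapply tr_conseq.
  { refine (solve_correct N n r par tv bv HV (A 0) _ _ _ w C Bd HC HWb HBd m1 A t1
      (fun R' A' t' => exists M, R' 1 = 2 * length M + 1 /\ R' 3 = K /\ R' 7 = 1 /\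
        A' out 0 = length M /\ written A' M /\ 2 * length M <= n /\
        is_maximum_matching (rdv_edge N n par tv bv) M /\ 14 * B + 300 <= t') 
      _ _ _ _ _ _ m1 Hrep); auto.
    - intros x Hx. rewrite HA by lia. now apply input_par.
    - intros v Hv. rewrite HA by lia. now apply input_ends.
    - intros v Hv. rewrite HA by lia. now apply input_ends.
    - intros j i Hj. unfold A. now apply Hz.
    - lia.
    - intros R' A' t' M H1 H3 H7 H0 HMw HMn HMm Ht'. exists M.
      repeat (split; auto). lia. }
  clear A HA Hrep Hin Hz m1 R20 R1 R5 t1 Ht1.
  intros m2 t2 (R & A & (Hr1 & Hr2 & Hr3) & M & H1 & H3 & H7 & H0 & HMw & HMn & HMm & Ht2).
  assert (HW32 : C + out + J * K < 2 ^ w) by (unfold C, B in *; lia).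
  apply tr_seq, (copy_out_correct w C HC) with (o := A out) (e := 2 * length M + 1);
    try (rewrite Hr1 by lia); auto; try (unfold C, B in *; lia).
  { intros i. apply Hr3. lia. }
  intros m3 t3 G20 Go Gc Ht3.
  apply tr_seq, tr_move with (v := C); [auto | lia |].
  apply tr_seq, tr_const; [lia | lia |].
  apply tr_seq, tr_add with (v := C + out); [upds; lia | lia | lia |].
  apply (loads_correct w C HC) with (o := A out); upds; auto; try lia.
  { intros i. upds. rewrite <- Go. f_equal. lia. }
  intros m4 t4 L1 L2. exists M. split; auto.
  assert (Hm : forall i, i < 2 * length M + 1 -> m4 i = A out i).
  { intros i Hi. destruct (le_lt_dec K i).
    - rewrite L2 by lia. upds. apply Gc. lia.
    - apply L1. lia. }
  split.
  - rewrite Hm by lia. exact H0.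
  - intros i Hi. rewrite !Hm by lia. now apply HMw.
Qed.
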